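(* Let $\phi,\psi:[0,+\infty)\times\mathbb{R}^n\to\mathbb{R}^n$ satisfy conditions (i)–(iii) of the context, and let $y_0(t)$, $t\ge0$, be a bounded solution of $\dot y=\psi(t,y)$. Let $C$ be a real symmetric $n\times n$ matrix all of whose eigenvalues are $\le-\alpha$ for some $\alpha>0$, and let $\xi_0\in\mathbb{R}^n$. Put $$s(t,\xi_0,x)=e^{Ct}(\xi_0-y_0(0))-(x-y_0(t)),\qquad t\ge0,\ x\in\mathbb{R}^n.$$ Assume that $B$ is a real negative definite $n\times n$ matrix, fix an initial value $u_0\in\mathbb{R}^n$, and for $\varepsilon>0$ consider the system $$\begin{cases}\dot x=\phi(t,x)-Bu,\\[2pt] \varepsilon\dot u=\dfrac{\partial s}{\partial t}(t,\xi_0,x)+\dfrac{\partial s}{\partial x}(t,\xi_0,x)\,[\phi(t,x)-Bu].\end{cases}$$ Then for any $\delta>0$ there exists $\varepsilon>0$ such that $$\lim_{t\to\infty}|x_\varepsilon(t)-y_0(t)|<\delta,$$ where $x_\varepsilon(t)$, $t\ge0$, is the $x$-component of the solution of this system such that $x_\varepsilon(0)=\xi_0$ (and $u(0)=u_0$).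
   Context: Conditions on $\phi,\psi$: (i) $t\mapsto\phi(t,x)$ and $t\mapsto\psi(t,x)$ are Lebesgue measurable for any $x\in\mathbb{R}^n$; $x\mapsto\phi(t,x)$ and $x\mapsto\psi(t,x)$ are locally Lipschitz for almost all $t\ge0$. (ii) For any $\rho>0$ there exists an integrable function $\gamma_\rho(t)$, $t\ge0$, such that $|\phi(t,x)|\le\gamma_\rho(t)$ and $|\psi(t,x)|\le\gamma_\rho(t)$ for almost all $t\ge0$ and any $x\in\mathbb{R}^n$ with $|x|\le\rho$. (iii) Any local solution of the Cauchy problems $\dot x=\phi(t,x)$, $x(0)=x_0\in\mathbb{R}^n$, and $\dot y=\psi(t,y)$, $y(0)=y_0\in\mathbb{R}^n$, can be extended to $[0,+\infty)$. With $s(t,\xi_0,x)=e^{Ct}(\xi_0-y_0(0))-(x-y_0(t))$, where $y_0(t)$, $t\ge0$, is the given bounded solution of $\dot y=\psi(t,y)$, $C$ is the given real symmetric $n\times n$ matrix with all eigenvalues $\le-\alpha<0$, and $\xi_0\in\mathbb{R}^n$, one has $\frac{\partial s}{\partial t}(t,\xi_0,x)=Ce^{Ct}(\xi_0-y_0(0))+\dot y_0(t)$ (for almost all $t$, with $\dot y_0(t)=\psi(t,y_0(t))$) and $\frac{\partial s}{\partial x}=-\mathrm{Id}$. Solutions are understood as absolutely continuous functions satisfying the equations for almost all $t\ge 0$. *)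

(* Defs.v *)
From HB Require Import structures.
From mathcomp Require Import all_boot all_order all_algebra.
From mathcomp Require Import all_classical all_reals all_analysis.

Set Implicit Arguments.
Unset Strict Implicit.
Unset Printing Implicit Defensive.

Import Order.TTheory GRing.Theory Num.Theory.
Import numFieldNormedType.Exports.

Local Open Scope classical_set_scope.
Local Open Scope ring_scope.

(* The library norm on matrices is the sup norm; [enorm] is the Euclidean norm
   of R^n.  Limits and derivatives do not depend on this choice. *)
Definition enorm (R : realType) (n : nat) (v : 'cV[R]_n) : R :=
  Num.sqrt (\sum_(i < n) v i 0 ^+ 2).

Definition expmx (R : realType) (n : nat) (A : 'M[R]_n) : 'M[R]_n :=
  lim (series (fun k => k`!%:R^-1 *: A ^+ k) @ \oo).

Definition negative_definite (R : realType) (n : nat) (B : 'M[R]_n) : Prop :=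
  forall v : 'cV[R]_n, v != 0 -> (v^T *m B *m v) 0 0 < 0.

(* R with the sigma-algebra of Lebesgue measurable sets, whereas the default
   sigma-algebra on R is the Borel one. *)
Definition lebesgueType (R : realType) : measurableType _ :=
  caratheodory_type ((@wlength R idfun)^*)%mu.

Definition abs_continuous (R : realType) (n : nat) (a b : R)
    (x : R -> 'cV[R]_n) : Prop :=
  forall e : R, 0 < e -> exists2 d : R, 0 < d &
    forall (m : nat) (p q : 'I_m -> R),
      (forall k, a <= p k /\ p k < q k /\ q k <= b) ->
      trivIset setT (fun k => `]p k, q k[%classic) ->
      \sum_(k < m) (q k - p k) < d ->
      \sum_(k < m) enorm (x (q k) - x (p k)) < e.

(* Solutions on [0, T), where T may be +oo; nothing is said of x outside this
   interval. *)
Definition is_solution (R : realType) (n : nat)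
    (f : R -> 'cV[R]_n -> 'cV[R]_n) (T : \bar R) (x : R -> 'cV[R]_n) : Prop :=
  (forall b : R, 0 <= b -> (b%:E < T)%E -> abs_continuous 0 b x) /\
  {ae lebesgue_measure, forall t : R, 0 <= t -> (t%:E < T)%E ->
    is_derive t 1 x (f t (x t))}.

Definition measurable_in_time (R : realType) (n : nat)
    (f : R -> 'cV[R]_n -> 'cV[R]_n) : Prop :=
  forall (x : 'cV[R]_n) (i : 'I_n),
    measurable_fun (`[0, +oo[%classic : set (lebesgueType R))
      (fun t => f t x i 0).

Definition locally_lipschitz (R : realType) (n : nat)
    (g : 'cV[R]_n -> 'cV[R]_n) : Prop :=
  forall x : 'cV[R]_n, exists2 U, nbhs x U & [lipschitz g y | y in U].

Definition locally_lipschitz_in_space (R : realType) (n : nat)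
    (f : R -> 'cV[R]_n -> 'cV[R]_n) : Prop :=
  {ae lebesgue_measure, forall t : R, 0 <= t -> locally_lipschitz (f t)}.

(* Both fields share the same dominating function on each ball. *)
Definition integrably_bounded (R : realType) (n : nat)
    (phi psi : R -> 'cV[R]_n -> 'cV[R]_n) : Prop :=
  forall rho : R, 0 < rho -> exists2 gamma : R -> R,
    (@completed_lebesgue_measure R).-integrable `[0, +oo[%classic
      (fun t => (gamma t)%:E) &
    {ae lebesgue_measure, forall t : R, 0 <= t ->
      forall x : 'cV[R]_n, enorm x <= rho ->
        enorm (phi t x) <= gamma t /\ enorm (psi t x) <= gamma t}.

Definition solutions_extendable (R : realType) (n : nat)
    (f : R -> 'cV[R]_n -> 'cV[R]_n) : Prop :=
  forall (x0 : 'cV[R]_n) (T : R) (x : R -> 'cV[R]_n),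
    0 < T -> is_solution f T%:E x -> x 0 = x0 ->
    exists2 z : R -> 'cV[R]_n, is_solution f +oo%E z &
      forall t : R, 0 <= t < T -> z t = x t.

Definition sliding (R : realType) (n : nat) (C : 'M[R]_n) (y0 : R -> 'cV[R]_n)
    (xi0 : 'cV[R]_n) (t : R) (x : 'cV[R]_n) : 'cV[R]_n :=
  expmx (t *: C) *m (xi0 - y0 0) - (x - y0 t).

(* Solutions on [0, +oo) with initial value (xi0, u0) of
     x' = phi(t, x) - B u,
     eps u' = ds/dt(t, x) + ds/dx(t, x) [phi(t, x) - B u]. *)
Definition is_feedback_solution (R : realType) (n : nat)
    (phi : R -> 'cV[R]_n -> 'cV[R]_n) (B : 'M[R]_n)
    (s : R -> 'cV[R]_n -> 'cV[R]_n) (xi0 u0 : 'cV[R]_n) (eps : R)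
    (x u : R -> 'cV[R]_n) : Prop :=
  [/\ x 0 = xi0, u 0 = u0,
      forall b : R, 0 <= b -> abs_continuous 0 b x /\ abs_continuous 0 b u &
      {ae lebesgue_measure, forall t : R, 0 <= t ->
        [/\ is_derive t 1 x (phi t (x t) - B *m u t),
            derivable u t 1 &
            eps *: 'D_1 u t = 'D_1 (fun r : R => s r (x t)) t
              + 'd (s t) (x t) (phi t (x t) - B *m u t)]}].

(* Main.v *)
Require Import Defs.
From HB Require Import structures.
From mathcomp Require Import all_boot all_order all_algebra.
From mathcomp Require Import all_classical all_reals all_analysis.
From mathcomp Require Import measurable_realfun.
From mathcomp Require Import ring lra.

(** Along a solution, the right-hand side of the equation of [u] is the time
    derivative of [s(t, x(t))], where [s] vanishes at the initial point.  Hence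
    [eps (u - u0) = s(t, x)] ([feedback_controlE]), that is,

      [x = y0 + z + eps u0 - v],  [z(t) = e^(C t) (xi0 - y0(0))],  [v = eps u].

    The transient [z] decays exponentially, because a symmetric matrix is bounded
    above by its largest eigenvalue.  Differentiating the identity gives

      [v' = eps^-1 B v + w],  [w = C z + psi(t, y0) - phi(t, x)].

    As long as [x] stays in a fixed ball, [|w|] is at most the integrable function
    [2 gamma(t) + K e^(- alpha t)].  Since [B] is negative definite, the energy
    [|v|^2] is damped at the rate [2 beta / eps], and a Gronwall inequality bounds
    it by its damped past value plus the recent increase of a bounded function [J]
    ([energy_estimate]).  By absolute continuity, [J] increases little over a
    short window; for small [eps] the damping over such a window is strong.
    Hence [v] is small, which keeps [x] strictly inside the ball, so that the
    assumption on [x] sustains itself ([state_stays], by real induction).  At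
    infinity [v] and [z] tend to zero, and [|x - y0|] tends to [eps |u0|], which is
    less than [delta] for small [eps] ([state_limit]).

    The system also has a solution.  Eliminating [u] and retracting the state onto
    the ball leaves a Carathéodory equation with an integrably bounded right-hand
    side.  The local Lipschitz constants of [phi(t, .)] need not be integrable in
    [t], so Picard iteration does not apply; instead a solution is obtained from
    Euler polygons by compactness and dominated convergence
    ([caratheodory_existence]).  The a priori estimate applies to it, so that it
    never leaves the ball and solves the original system.

    Almost everywhere differentiable functions enter these arguments through one
    fact, proved with the help of real induction: an absolutely continuous
    function whose derivative is almost everywhere nonpositive is nonincreasing
    ([ac_nonincreasing]). *)

Set Implicit Arguments.
Unset Strict Implicit.
Unset Printing Implicit Defensive.

Import Order.TTheory GRing.Theory Num.Theory.
Import numFieldNormedType.Exports.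

Local Open Scope classical_set_scope.
Local Open Scope ring_scope.

(** * Real induction and absolute continuity *)

(** The infimum of the counterexamples would satisfy [P] by the first
    hypothesis, and would not be a limit of counterexamples by the second. *)
Lemma real_induction (R : realType) (a b : R) (P : R -> Prop) :
  (forall t, a <= t <= b -> (forall s, a <= s < t -> P s) -> P t) ->
  (forall t, a <= t < b -> (forall s, a <= s <= t -> P s) ->
     exists2 d : R, 0 < d & forall s, t < s < t + d -> s <= b -> P s) ->
  forall t, a <= t <= b -> P t.
Proof.
move=> Pclosed Popen t0 /andP[at0 t0b]; apply: contrapT => nPt0.
pose S := [set t | a <= t <= t0 /\ ~ P t].
have St0 : S t0 by split=> //; rewrite at0 lexx.
have hS : has_inf S by split; [exists t0|exists a => s [/andP[]]].
pose m := inf S.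
have am : a <= m by apply: lb_le_inf; [exists t0|move=> s [/andP[]]].
have mt0 : m <= t0 by apply: ge_inf => //; case: hS.
have Plt s : a <= s < m -> P s.
  move=> /andP[a_s sm]; apply: contrapT => nPs.
  have : m <= s.
    apply: ge_inf; first by case: hS.
    by split=> //; rewrite a_s (le_trans (ltW sm)).
  by rewrite leNgt sm.
have Pm : P m by apply: Pclosed => //; rewrite am (le_trans mt0).
have mltt0 : m < t0.
  by rewrite lt_neqAle mt0 andbT; apply/eqP => mt; apply: nPt0; rewrite -mt.
have [||d d0 Pd] := Popen m.
- by rewrite am (lt_le_trans mltt0).
- by move=> s /andP[a_s]; rewrite le_eqVlt => /predU1P[->//|sm]; apply: Plt; rewrite a_s.
have : m + d <= m.
  apply: lb_le_inf; first by exists t0.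
  move=> s [/andP[a_s st0] nPs]; rewrite leNgt; apply/negP => smd; apply: nPs.
  have [sm|ms|->//] := ltgtP s m; first by apply: Plt; rewrite a_s.
  by apply: Pd; rewrite ?ms ?smd// (le_trans st0).
by rewrite gerDl leNgt d0.
Qed.

(** The increment function [D p q] stands for [|x q - x p|]: working with it
    instead of [x] treats scalar and vector functions, and the estimates that
    combine several of them, in one go. *)
Definition ac (R : realType) (D : R -> R -> R) (a b : R) : Prop :=
  forall e : R, 0 < e -> exists2 d : R, 0 < d &
    forall (m : nat) (p q : 'I_m -> R),
      (forall k, a <= p k /\ p k < q k /\ q k <= b) ->
      trivIset setT (fun k => `]p k, q k[%classic) ->
      \sum_(k < m) (q k - p k) < d ->
      \sum_(k < m) D (p k) (q k) < e.

Lemma ac_le (R : realType) (D D1 D2 : R -> R -> R) (a b K : R) : 0 <= K ->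
  ac D1 a b -> ac D2 a b ->
  (forall p q, a <= p -> p < q -> q <= b -> D p q <= K * (D1 p q + D2 p q)) ->
  ac D a b.
Proof.
move=> K0 ac1 ac2 DK e e0.
have K1 : 0 < K + 1 by rewrite ltr_wpDl.
have e1 : 0 < e / (K + 1) / 2 by rewrite !divr_gt0.
have [d1 d10 D1e] := ac1 _ e1; have [d2 d20 D2e] := ac2 _ e1.
exists (Num.min d1 d2); first by rewrite lt_min d10.
move=> m p q pq tpq; rewrite lt_min => /andP[sd1 sd2].
have {D1e}S1 := D1e m p q pq tpq sd1; have {D2e}S2 := D2e m p q pq tpq sd2.
apply: (@le_lt_trans _ _ (\sum_(k < m) K * (D1 (p k) (q k) + D2 (p k) (q k)))).
  by apply: ler_sum => k _; have [? [? ?]] := pq k; exact: DK.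
rewrite -mulr_sumr big_split/=.
have : \sum_(i < m) D1 (p i) (q i) + \sum_(i < m) D2 (p i) (q i) <= e / (K + 1).
  by rewrite [leRHS]splitr lerD// ltW.
move=> /(ler_wpM2l K0) /le_lt_trans; apply.
by rewrite mulrA ltr_pdivrMr// mulrC ltr_pM2l// ltrDl.
Qed.

Lemma ac_le1 (R : realType) (D D1 : R -> R -> R) (a b K : R) : 0 <= K ->
  ac D1 a b ->
  (forall p q, a <= p -> p < q -> q <= b -> D p q <= K * D1 p q) ->
  ac D a b.
Proof.
move=> K0 ac1 DK; apply: (@ac_le _ _ _ _ _ _ (K / 2) _ ac1 ac1); first by rewrite divr_ge0.
move=> p q ap pq qb; rewrite (le_trans (DK _ _ ap pq qb))//.
by rewrite le_eqVlt; apply/orP; left; apply/eqP; field.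
Qed.

Lemma ac_lipschitz (R : realType) (D : R -> R -> R) (a b K : R) : 0 <= K ->
  (forall p q, a <= p -> p < q -> q <= b -> D p q <= K * (q - p)) ->
  ac D a b.
Proof.
move=> K0 DK; apply: (@ac_le1 _ _ (fun p q => q - p) _ _ K) => //.
by move=> e e0; exists e.
Qed.

Lemma ac_sum (R : realType) (n : nat) (D : 'I_n -> R -> R -> R) (a b : R) :
  (forall i, ac (D i) a b) -> ac (fun p q => \sum_(i < n) D i p q) a b.
Proof.
elim: n D => [|n IH] D acD.
  apply: (@ac_lipschitz _ _ _ _ 0) => // p q _ _ _.
  by rewrite big_ord0 mul0r.
apply: (@ac_le _ _ _ _ _ _ 1 ler01 (IH _ (fun i => acD (lift ord0 i))) (acD ord0)).
by move=> p q _ _ _; rewrite mul1r big_ord_recl addrC.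
Qed.

Lemma ac_sub (R : realType) (D : R -> R -> R) (a b c d : R) :
  a <= c -> d <= b -> ac D a b -> ac D c d.
Proof.
move=> ac_ db acD e /acD[r r0 De]; exists r => // m p q pq; apply: De => k.
by have [cp [? qd]] := pq k; rewrite (le_trans ac_)// (le_trans qd).
Qed.

Lemma ac_near (R : realType) (D : R -> R -> R) (a b : R) : ac D a b ->
  forall e : R, 0 < e -> exists2 d : R, 0 < d &
    forall p q, a <= p -> p < q -> q <= b -> q - p < d -> D p q < e.
Proof.
move=> acD e /acD[d d0 De]; exists d => // p q ap pq qb qpd.
have := De 1%N (fun=> p) (fun=> q); rewrite !big_ord1; apply => //.
by apply/trivIsetP => i j _ _; rewrite (ord1 i) (ord1 j).
Qed.

Lemma ac_within_continuous (R : realType) (f : R -> R) (a b : R) :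
  ac (fun p q => `|f q - f p|) a b -> {within `[a, b], continuous f}.
Proof.
move=> acf; apply/subspace_continuousP => x /=; rewrite in_itv/= => /andP[ax xb].
apply/cvgrPdist_lt => e e0.
have [d d0 De] := ac_near acf e0.
rewrite near_withinE; near=> y => /=; rewrite in_itv/= => /andP[ay yb].
have xyd : `|x - y| < d by near: y; exact: cvgr_dist_lt.
have [xy|yx|->] := ltgtP x y; last by rewrite subrr normr0.
  by rewrite distrC; apply: De => //; rewrite -(gtr0_norm (x := y - x)) ?subr_gt0// distrC.
by apply: De => //; rewrite -(gtr0_norm (x := x - y)) ?subr_gt0.
Unshelve. all: by end_near. Qed.

Lemma ac_bounded (R : realType) (f : R -> R) (a b : R) : a <= b ->
  ac (fun p q => `|f q - f p|) a b ->
  exists2 M : R, 0 <= M & forall t, a <= t <= b -> `|f t| <= M.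
Proof.
move=> ab acf.
have cnf : {within `[a, b], continuous (fun t => `|f t|)}.
  apply: ac_within_continuous; apply: (ac_le1 ler01 acf) => p q _ _ _.
  by rewrite mul1r ler_dist_dist.
have [c cab fc] := EVT_max ab cnf.
by exists `|f c| => // t tab; apply: fc; rewrite in_itv.
Qed.

Lemma acM (R : realType) (f g : R -> R) (a b : R) : a <= b ->
  ac (fun p q => `|f q - f p|) a b -> ac (fun p q => `|g q - g p|) a b ->
  ac (fun p q => `|f q * g q - f p * g p|) a b.
Proof.
move=> ab acf acg.
have [M M0 fM] := ac_bounded ab acf; have [N N0 gN] := ac_bounded ab acg.
apply: (@ac_le _ _ _ _ _ _ (M + N) _ acf acg); first exact: addr_ge0.
move=> p q ap pq qb.
have -> : f q * g q - f p * g p = f q * (g q - g p) + (f q - f p) * g p by ring.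
have fq : `|f q| <= M by apply: fM; rewrite qb (le_trans ap (ltW pq)).
have gp : `|g p| <= N by apply: gN; rewrite ap (le_trans (ltW pq) qb).
rewrite (le_trans (ler_normD _ _))// !normrM.
have := normr_ge0 (g q - g p); have := normr_ge0 (f q - f p).
nra.
Qed.

(** * Nonpositive derivative almost everywhere *)

Lemma negligible_open_cover (R : realType) (N : set R) (d : R) : 0 < d ->
  (@lebesgue_measure R).-negligible N ->
  exists O : set R, [/\ open O, N `<=` O & (lebesgue_measure O < d%:E)%E].
Proof.
move=> d0 [A [mA A0 NA]].
have [|O [oO AO Od]] := lebesgue_regularity_outer mA _ d0.
  by rewrite [X in (X < _)%E](A0 : _ = 0%E).
exists O; split=> //; first exact: subset_trans AO.
have -> : O = (O `\` A) `|` A by rewrite setUC setDUK.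
rewrite (le_lt_trans (measureU2 _ _ _))//=; last by rewrite [X in (_ + X)%E](A0 : _ = 0%E) adde0.
by apply: measurableD => //; exact: open_measurable.
Qed.

Lemma sum_disjoint_itv (R : realType) (O : set R) (m : nat) (p q : 'I_m -> R) :
  measurable O ->
  (forall k, p k < q k) -> (forall k, `]p k, q k[%classic `<=` O) ->
  trivIset setT (fun k => `]p k, q k[%classic) ->
  ((\sum_(k < m) (q k - p k))%:E <= lebesgue_measure O)%E.
Proof.
move=> mO pq pqO tpq.
have -> : (\sum_(k < m) (q k - p k))%:E =
    lebesgue_measure (\big[setU/set0]_(k < m) `]p k, q k[%classic).
  rewrite measure_bigsetU_ord//.
  rewrite -sumEFin; apply: eq_bigr => k _.
  by have := lebesgue_measure_itv `]p k, q k[; rewrite /= lte_fin pq -EFinB => <-.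
apply: le_measure; rewrite ?inE//.
  by apply: bigsetU_measurable.
by rewrite -bigcup_seq; apply: bigcup_sub => k _; exact: pqO.
Qed.

(** Real induction reaches a point from the left and leaves it to the right,
    whence the bounds on both sides. *)
Lemma is_derive_slope (R : realType) (f : R -> R) (t l e : R) : 0 < e ->
  is_derive t 1 f l -> l <= 0 ->
  exists2 d : R, 0 < d &
    forall s, (t < s -> s < t + d -> f s - f t <= e * (s - t)) /\
              (s < t -> t - d < s -> f t - f s <= e * (t - s)).
Proof.
move=> e0 [dft dfE] l0.
have : h^-1 *: (f (h *: 1 + t) - f t) @[h --> 0^'] --> l.
  by rewrite -dfE; exact: dft.
move=> /cvgrPdist_le/(_ e e0) [d /= d0 Hd].
have Hh h : h != 0 -> `|h| < d -> (h^-1 * (f (h + t) - f t)) <= e.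
  move=> h0 hd; have := Hd h; rewrite /ball_/= sub0r normrN => /(_ hd h0).
  rewrite /GRing.scale/= mulr1 ler_norml => /andP[+ _]; lra.
exists d => // s; split=> [ts sd|st sd].
  have := Hh (s - t); rewrite subr_eq0 gt_eqF// gtr0_norm ?subr_gt0//.
  rewrite subrK ltrBlDl => /(_ isT sd).
  by rewrite mulrC ler_pdivrMr ?subr_gt0.
have := Hh (s - t); rewrite subr_eq0 lt_eqF// ltr0_norm ?subr_lt0//.
rewrite subrK opprB ltrBlDl -ltrBlDr => /(_ isT sd).
by rewrite mulrC ler_ndivrMr ?subr_lt0// => ?; lra.
Qed.

#[local] Instance ae_lebesgue_filter (R : realType) :
  Filter (nbhs (almost_everywhere (@lebesgue_measure R))).
Proof. exact: ae_filter_ringOfSetsType. Qed.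

(** Up to a given error [e], the exceptional null set can be ignored: it lies in
    an open set [U] so small that, by absolute continuity, [f] varies by less
    than [e] over disjoint intervals of [U].  Real induction carries a bound of
    [f t - f a] from [a] to [b]; to pass a point [t] outside [U] it uses that
    [f] has slope at most [e] near [t], and to pass a point of [U] it adds one
    more interval of [U] to the bound. *)
Lemma ac_nonincreasing (R : realType) (f : R -> R) (a b : R) : a <= b ->
  ac (fun p q => `|f q - f p|) a b ->
  {ae lebesgue_measure, forall t : R, a < t -> t < b ->
    exists2 l : R, l <= 0 & is_derive t 1 f l} ->
  f b <= f a.
Proof.
move=> ab acf f'le0.
suff key e : 0 < e -> f b - f a <= e * (b - a) + e.
  rewrite -subr_le0; apply/ler_addgt0Pr => e e0; rewrite add0r.
  have ba1 : 0 < b - a + 1 by rewrite ltr_wpDl ?subr_ge0.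
  have := key (e / (b - a + 1)) (divr_gt0 e0 ba1).
  by rewrite -{2}[e / _]mulr1 -mulrDr divfK ?gt_eqF.
move=> e0; have [d d0 De] := acf e e0.
pose N := ~` [set t : R | a < t -> t < b ->
    exists2 l : R, l <= 0 & is_derive t 1 f l] `|` [set a] `|` [set b].
have nN : (@lebesgue_measure R).-negligible N.
  apply: negligibleU; first apply: negligibleU => //.
    by apply/negligibleP => //; exact: lebesgue_measure_set1.
  by apply/negligibleP => //; exact: lebesgue_measure_set1.
have [U [oU NU Ud]] := negligible_open_cover d0 nN.
have mU := open_measurable oU.
(* [P t] bounds the increment of [f] over [[a, t]] by its increments over
   finitely many disjoint intervals of [U] and a small slope elsewhere. *)
pose P t := exists (m : nat) (p q : nat -> R),
  [/\ forall k, (k < m)%N -> [/\ a <= p k, p k < q k, q k <= t & `]p k, q k[%classic `<=` U],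
      trivIset [set k | (k < m)%N] (fun k => `]p k, q k[%classic) &
      f t - f a <= e * (t - a) + \sum_(k < m) `|f (q k) - f (p k)|].
have Pa : P a.
  exists 0%N, (fun=> 0), (fun=> 0); split=> //; last by rewrite big_ord0 !subrr mulr0 addr0.
have Pgood s t : s < t -> f t - f s <= e * (t - s) -> P s -> P t.
  move=> st fts [m [p [q [pq tpq fs]]]]; exists m, p, q; split=> //.
    by move=> k /pq[? ? qs ?]; split=> //; rewrite (le_trans qs)// ltW.
  have -> : t - a = (t - s) + (s - a) by ring.
  by rewrite mulrDr; lra.
have Pbad s t : a <= s -> s < t -> `]s, t[%classic `<=` U -> P s -> P t.
  move=> a_s st stU [m [p [q [pq tpq fs]]]].
  exists m.+1, (fun k => if k == m then s else p k), (fun k => if k == m then t else q k).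
  split.
  - move=> k; rewrite ltnS leq_eqVlt; have [->|km] := eqVneq k m; first by split.
    by move=> /= /pq[? ? qs ?]; split=> //; rewrite (le_trans qs)// ltW.
  - have disj k : (k < m)%N -> `]s, t[%classic `&` `]p k, q k[%classic = set0.
      move=> /pq[? ? qs ?]; apply/seteqP; split=> // x [/=]; rewrite !in_itv/=.
      by move=> /andP[sx _] /andP[_ xq]; have := lt_le_trans xq qs; rewrite ltNge (ltW sx).
    have ltm k : (k < m.+1)%N -> k != m -> (k < m)%N.
      by move=> km nkm; rewrite ltn_neqAle nkm -ltnS.
    apply/trivIsetP => i j /= /ltm im /ltm jm ij.
    move: ij im jm; have [->|_] := eqVneq i m; have [->|_] := eqVneq j m => //=.
    + by move=> _ _ /(_ isT) jm; exact: disj.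
    + by move=> _ /(_ isT) im _; rewrite setIC; exact: disj.
    + by move=> ij /(_ isT) im /(_ isT) jm; move/trivIsetP : tpq; exact.
  - rewrite big_ord_recr/= eqxx.
    under eq_bigr do rewrite ltn_eqF//.
    have := ler_norm (f t - f s); have : e * (s - a) <= e * (t - a).
      by rewrite ler_pM2l// lerB// ltW.
    lra.
have PT t : a <= t <= b -> P t.
  apply: real_induction => {}t.
    move=> /andP[]; rewrite le_eqVlt => /predU1P[<- //|at_ tb IH].
    have [Ut|nUt] := pselect (U t).
      have /nbhs_ballP[r /= r0 rU] : nbhs t U by apply: open_nbhs_nbhs.
      pose s := Num.max a (t - r / 2).
      have st : s < t by rewrite gt_max at_ ltrBlDr ltrDl divr_gt0.
      have a_s : a <= s by rewrite le_max lexx.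
      apply: (Pbad s) => //; last by apply: IH; rewrite a_s.
      move=> x /=; rewrite in_itv/= => /andP[sx xt]; apply: rU.
      rewrite /ball/= ltr_norml; move: sx; rewrite gt_max => /andP[_ sx].
      by apply/andP; split; lra.
    have [l l0 fl] : exists2 l : R, l <= 0 & is_derive t 1 f l.
      apply: contrapT => h; apply: nUt; apply: NU.
      have [->|nb] := eqVneq t b; first by right.
      by left; left => /(_ at_); rewrite lt_neqAle nb tb => /(_ isT).
    have [r r0 fr] := is_derive_slope e0 fl l0.
    pose s := Num.max a (t - r / 2).
    have st : s < t by rewrite gt_max at_ ltrBlDr ltrDl divr_gt0.
    have a_s : a <= s by rewrite le_max lexx.
    have trs : t - r < s.
      by rewrite lt_max; apply/orP; right; rewrite ltrD2l ltrN2 ltr_pdivrMr// ltr_pMr// ltr1n.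
    apply: (Pgood s) => //; last by apply: IH; rewrite a_s.
    by have [_] := fr s; apply.
  move=> /andP[at_ tb] IH.
  have Pt : P t by apply: IH; rewrite at_ lexx.
  have [Ut|nUt] := pselect (U t).
    have /nbhs_ballP[r /= r0 rU] : nbhs t U by apply: open_nbhs_nbhs.
    exists r => // s /andP[ts str] _; apply: (Pbad t) => // x /=.
    rewrite in_itv/= => /andP[tx xs]; apply: rU.
    by rewrite /ball/= ltr_norml; apply/andP; split; lra.
  have at' : a < t.
    rewrite lt_neqAle at_ andbT; apply/eqP => aE; apply: nUt; apply: NU.
    by left; right.
  have [l l0 fl] : exists2 l : R, l <= 0 & is_derive t 1 f l.
    apply: contrapT => h; apply: nUt; apply: NU.
    by left; left => /(_ at' tb).
  have [r r0 fr] := is_derive_slope e0 fl l0.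
  exists r => // s /andP[ts str] _; apply: (Pgood t) => //.
  by have [+ _] := fr s; apply.
have [|m [p [q [pq tpq fb]]]] := PT b; first by rewrite ab lexx.
rewrite (le_trans fb)// lerD2l ltW// (De m (fun k => p k) (fun k => q k))//.
- by move=> k; have [] := pq k.
- apply/trivIsetP => i j _ _ ij; move/trivIsetP : tpq; apply => //=.
- rewrite -lte_fin (le_lt_trans _ Ud)//; apply: sum_disjoint_itv => //.
  + by move=> k; have [] := pq k.
  + by move=> k; have [] := pq k.
  + by apply/trivIsetP => i j _ _ ij; move/trivIsetP : tpq; apply => //=.
Qed.

Lemma ac_constant (R : realType) (f : R -> R) (a b : R) : a <= b ->
  ac (fun p q => `|f q - f p|) a b ->
  {ae lebesgue_measure, forall t : R, a < t -> t < b -> is_derive t 1 f 0} ->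
  f b = f a.
Proof.
move=> ab acf f'0; apply/eqP; rewrite eq_le; apply/andP; split.
  apply: ac_nonincreasing => //; apply: filterS f'0 => t f'0 at_ tb.
  by exists 0 => //; exact: f'0.
rewrite -lerN2; apply: (@ac_nonincreasing _ (fun t => - f t)) => //.
  by apply: (ac_le1 ler01 acf) => p q _ _ _; rewrite mul1r -opprD normrN.
apply: filterS f'0 => t f'0 at_ tb; exists 0 => //.
by rewrite -oppr0; apply: is_deriveN; exact: f'0.
Qed.

(** * Gronwall inequality *)

Lemma ac_bounded_derivative (R : realType) (f df : R -> R) (a b K : R) :
  (forall t : R, a <= t <= b -> is_derive t 1 f (df t)) ->
  (forall t, a <= t <= b -> `|df t| <= K) ->
  ac (fun p q => `|f q - f p|) a b.
Proof.
move=> fdf dfK; apply: (@ac_lipschitz _ _ _ _ `|K|) => // p q ap pq qb.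
have itvpq t : t \in `[p, q] -> a <= t <= b.
  by rewrite in_itv/= => /andP[pt tq]; rewrite (le_trans ap pt) (le_trans tq qb).
have [| |c cpq ->] := @MVT_segment R f df p q (ltW pq).
- by move=> t tpq; apply/fdf/itvpq; apply: subset_itv_oo_cc.
- apply: derivable_within_continuous => t tpq.
  by have [] := fdf _ (itvpq _ tpq).
- rewrite normrM (gtr0_norm (x := q - p)) ?subr_gt0//.
  apply: ler_wpM2r; first by rewrite subr_ge0 ltW.
  by rewrite (le_trans (dfK _ (itvpq _ cpq)))// ler_norm.
Qed.

Lemma is_derive_expRM (R : realType) (k t : R) :
  is_derive t 1 (fun r => expR (k * r)) (k * expR (k * t)).
Proof.
rewrite mulrC; apply: (@is_derive1_comp _ expR ( *%R k)).
have := @is_deriveZ _ _ _ id k t 1 1 (is_derive_id t 1).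
by rewrite /GRing.scale/= mulr1.
Qed.

(** The function [e^(k t) V(t) - e^(k T) J(t)] is nonincreasing on [[s, T]]: its
    derivative is at most [(e^(k t) - e^(k T)) J'(t)], and [J' >= 0].  Giving [J]
    the constant weight [e^(k T)] lets it enter the estimate only through its
    total increase. *)
Lemma gronwall (R : realType) (V J : R -> R) (k s T : R) : 0 <= k -> s <= T ->
  ac (fun p q => `|V q - V p|) s T -> ac (fun p q => `|J q - J p|) s T ->
  {ae lebesgue_measure, forall t : R, s < t -> t < T -> exists dV dJ : R,
    [/\ is_derive t 1 V dV, is_derive t 1 J dJ, 0 <= dJ & dV <= - k * V t + dJ]} ->
  V T <= expR (- k * (T - s)) * V s + (J T - J s).
Proof.
move=> k0 sT acV acJ dVJ.
pose E t : R := expR (k * t).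
have acE : ac (fun p q => `|E q - E p|) s T.
  apply: (@ac_bounded_derivative _ _ (fun t => k * E t) _ _ (k * E T)) => t.
    by move=> _; exact: is_derive_expRM.
  move=> /andP[_ tT]; rewrite ger0_norm ?mulr_ge0 ?expR_ge0// ler_wpM2l//.
  by rewrite ler_expR ler_wpM2l.
pose f t := E t * V t - E T * J t.
have : f T <= f s.
  apply: ac_nonincreasing => //.
    apply: (@ac_le _ _ _ _ _ _ (1 + E T) _ (acM sT acE acV) acJ).
      by rewrite addr_ge0// expR_ge0.
    move=> p q _ _ _; rewrite /f.
    have -> : E q * V q - E T * J q - (E p * V p - E T * J p) =
      (E q * V q - E p * V p) - E T * (J q - J p) by ring.
    rewrite (le_trans (ler_normB _ _))// normrM (ger0_norm (x := E T)) ?expR_ge0//.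
    have ET0 : 0 <= E T by exact: expR_ge0.
    have := normr_ge0 (E q * V q - E p * V p); have := normr_ge0 (J q - J p).
    nra.
  apply: filterS dVJ => t dVJ st tT; have [dV [dJ [Vt Jt dJ0 dVle]]] := dVJ st tT.
  exists (E t *: dV + V t *: (k * E t) - E T *: dJ); last first.
    apply: (@is_deriveB _ _ _ (E * V) (E T *: J)).
    exact: is_deriveM (is_derive_expRM k t) Vt.
  rewrite /GRing.scale/=.
  have Et0 : 0 <= E t by exact: expR_ge0.
  have EtT : E t <= E T by rewrite ler_expR ler_wpM2l// ltW.
  have h1 : E t * dV <= E t * (- k * V t + dJ) by rewrite ler_wpM2l.
  have h2 : E t * dJ <= E T * dJ by rewrite ler_wpM2r.
  lra.
rewrite /f => fTs.
have ET0 : 0 < E T by exact: expR_gt0.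
have -> : expR (- k * (T - s)) = E s / E T.
  by rewrite /E -expRN -expRD; congr expR; ring.
rewrite -(ler_pM2l ET0) mulrDr mulrA mulrCA divff ?gt_eqF// mulr1.
by move: fTs; rewrite mulrBr; lra.
Qed.

(** * Euclidean norm and quadratic forms *)

Lemma continuous_sumr (R : realType) (T : topologicalType) (n : nat)
    (f : 'I_n -> T -> R) : (forall i, continuous (f i)) ->
  continuous (fun x => \sum_(i < n) f i x).
Proof.
by move=> cf; apply: (@continuous_big _ _ _ _ _ _ _ _ f) => //; exact: add_continuous.
Qed.

Definition dotv (R : realType) (n : nat) (u v : 'cV[R]_n) : R :=
  \sum_(i < n) u i 0 * v i 0.

Section euclidean.
Variables (R : realType) (n : nat).
Implicit Types (u v w : 'cV[R]_n) (A : 'M[R]_n).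

Lemma dotvC u v : dotv u v = dotv v u.
Proof. by apply: eq_bigr => i _; rewrite mulrC. Qed.

Lemma dotvDr u v w : dotv u (v + w) = dotv u v + dotv u w.
Proof. by rewrite -big_split; apply: eq_bigr => i _; rewrite mxE mulrDr. Qed.

Lemma dotvZr (a : R) u v : dotv u (a *: v) = a * dotv u v.
Proof. by rewrite mulr_sumr; apply: eq_bigr => i _; rewrite mxE mulrCA. Qed.

Lemma dotvDl u v w : dotv (v + w) u = dotv v u + dotv w u.
Proof. by rewrite !(dotvC _ u) dotvDr. Qed.

Lemma dotvZl (a : R) u v : dotv (a *: u) v = a * dotv u v.
Proof. by rewrite !(dotvC _ v) dotvZr. Qed.

Lemma dotv0 u : dotv u 0 = 0.
Proof. by rewrite -(scale0r 0) dotvZr mul0r. Qed.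

Lemma dotv_mx u v A : (u^T *m A *m v) 0 0 = dotv u (A *m v).
Proof. by rewrite -mulmxA mxE; apply: eq_bigr => i _; rewrite mxE. Qed.

Lemma dotv_trmx u v A : dotv u (A *m v) = dotv (A^T *m u) v.
Proof.
rewrite -dotv_mx -[u^T *m A]trmxK trmx_mul trmxK mxE.
by apply: eq_bigr => i _; rewrite mxE.
Qed.

Lemma dotvv_ge0 v : 0 <= dotv v v.
Proof. by apply: sumr_ge0 => i _; rewrite -expr2 sqr_ge0. Qed.

Lemma dotvv_eq0 v : (dotv v v == 0) = (v == 0).
Proof.
apply/idP/eqP => [|->]; last first.
  by rewrite /dotv big1// => i _; rewrite mxE mul0r.
rewrite psumr_eq0 => [/allP v0|i _]; last by rewrite -expr2 sqr_ge0.
apply/matrixP => i j; rewrite (ord1 j) mxE; apply/eqP.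
by have := v0 i (mem_index_enum i); rewrite mulf_eq0 orbb.
Qed.

Lemma enorm_ge0 v : 0 <= enorm v.
Proof. exact: sqrtr_ge0. Qed.

Lemma sqr_enorm v : enorm v ^+ 2 = dotv v v.
Proof.
rewrite sqr_sqrtr; last by apply: sumr_ge0 => i _; rewrite sqr_ge0.
by apply: eq_bigr => i _; rewrite expr2.
Qed.

Lemma enorm_eq0 v : (enorm v == 0) = (v == 0).
Proof. by rewrite -dotvv_eq0 -sqr_enorm sqrf_eq0. Qed.

Lemma enorm0 : enorm (0 : 'cV[R]_n) = 0.
Proof. by apply/eqP; rewrite enorm_eq0. Qed.

Lemma enormZ (a : R) v : enorm (a *: v) = `|a| * enorm v.
Proof.
apply/eqP; rewrite -(eqrXn2 (n := 2)) ?mulr_ge0 ?enorm_ge0//.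
by rewrite exprMn !sqr_enorm dotvZl dotvZr real_normK ?num_real// expr2 mulrA.
Qed.

Lemma enormN v : enorm (- v) = enorm v.
Proof. by rewrite -scaleN1r enormZ normrN1 mul1r. Qed.

Lemma dotv_le u v : dotv u v <= enorm u * enorm v.
Proof.
have [->|u0] := eqVneq u 0.
  by rewrite enorm0 mul0r /dotv big1// => i _; rewrite mxE mul0r.
have [->|v0] := eqVneq v 0.
  by rewrite enorm0 mulr0 dotv0.
have u_gt0 : 0 < enorm u by rewrite lt_neqAle enorm_ge0 eq_sym enorm_eq0 u0.
have v_gt0 : 0 < enorm v by rewrite lt_neqAle enorm_ge0 eq_sym enorm_eq0 v0.
have := dotvv_ge0 (enorm v *: u - enorm u *: v).
rewrite dotvDr !dotvDl -!scaleNr !dotvZl !dotvZr -!sqr_enorm (dotvC v u) => h.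
rewrite -subr_ge0 -(pmulr_rge0 _ (mulr_gt0 u_gt0 v_gt0)).
by move: h; nra.
Qed.

Lemma enormD u v : enorm (u + v) <= enorm u + enorm v.
Proof.
rewrite -(ler_pXn2r (n := 2)) ?nnegrE ?addr_ge0 ?enorm_ge0//.
rewrite sqr_enorm dotvDr !dotvDl -!sqr_enorm (dotvC v u) sqrrD.
by have := dotv_le u v; lra.
Qed.

Lemma enormB u v : enorm (u - v) <= enorm u + enorm v.
Proof. by rewrite -(enormN v) enormD. Qed.

Lemma enormBC u v : enorm (u - v) = enorm (v - u).
Proof. by rewrite -enormN opprB. Qed.

Lemma enorm_dist u v : `|enorm u - enorm v| <= enorm (u - v).
Proof.
rewrite ler_norml; apply/andP; split.
  by have := enormD (v - u) u; rewrite subrK enormBC; lra.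
by have := enormD (u - v) v; rewrite subrK; lra.
Qed.

Lemma enorm_coord v i : `|v i 0| <= enorm v.
Proof.
rewrite -sqrtr_sqr ler_wsqrtr// (bigD1 i)//= lerDl.
by apply: sumr_ge0 => j _; rewrite sqr_ge0.
Qed.

Lemma enorm_le_sum v : enorm v <= \sum_(i < n) `|v i 0|.
Proof.
have S0 : 0 <= \sum_(i < n) `|v i 0| by apply: sumr_ge0.
rewrite -(ler_pXn2r (n := 2)) ?nnegrE ?enorm_ge0// sqr_enorm expr2 mulr_suml.
apply: ler_sum => i _; rewrite (le_trans (ler_norm _))// normrM ler_wpM2l//.
by rewrite (bigD1 i)//= lerDl sumr_ge0.
Qed.

Lemma enorm_mulmx_bounded A :
  exists2 K : R, 0 < K & forall v, enorm (A *m v) <= K * enorm v.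
Proof.
exists (1 + \sum_(i < n) \sum_(j < n) `|A i j|).
  by rewrite ltr_pwDl//; apply: sumr_ge0 => i _; apply: sumr_ge0.
move=> v; apply: (le_trans (enorm_le_sum _)).
rewrite mulrDl mul1r mulr_suml ler_wpDl ?enorm_ge0//.
apply: ler_sum => i _; rewrite mxE mulr_suml (le_trans (ler_norm_sum _ _ _))//.
by apply: ler_sum => j _; rewrite normrM ler_wpM2l// enorm_coord.
Qed.

(** The Rayleigh quotient attains its maximum because the unit sphere is
    compact.  Cross-multiplying states this for all vectors [w], zero included. *)
Lemma quadratic_form_max A : (0 < n)%N -> exists2 v, v != 0 &
  forall w, dotv w (A *m w) * dotv v v <= dotv v (A *m v) * dotv w w.
Proof.
move=> n0.
pose S := [set r : 'rV[R]_n | dotv r^T r^T = 1].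
pose f (M : 'M[R]_n) (r : 'rV[R]_n) := dotv r^T (M *m r^T).
have cf M : continuous (f M).
  rewrite /f /dotv.
  have ct i : continuous (fun r : 'rV[R]_n => r^T i 0).
    by under eq_fun do rewrite mxE; exact: coord_continuous.
  apply: (continuous_sumr (f := fun i (r : 'rV[R]_n) => r^T i 0 * (M *m r^T) i 0)) => i.
  have cM : continuous (fun r : 'rV[R]_n => (M *m r^T) i 0).
    under eq_fun do rewrite mxE.
    apply: (continuous_sumr (f := fun j (r : 'rV[R]_n) => M i j * r^T j 0)) => j r.
    by apply: (@continuousM _ _ (fun=> M i j)); [exact: cst_continuous|exact: ct].
  by move=> r; apply: (@continuousM _ _ (fun r : 'rV[R]_n => r^T i 0)); [exact: ct|exact: cM].
have cS : compact S.
  apply: bounded_closed_compact.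
    exists 1; split; first exact: num_real.
    move=> M M1 r /= r1; apply: (le_trans _ (ltW M1)).
    rewrite [leLHS]/Num.Def.normr/= mx_normrE (bigmax_le _ ler01)//= => -[i j] _.
    rewrite ord1 /=; have := enorm_coord r^T j; rewrite mxE => /le_trans; apply.
    by rewrite -(ler_pXn2r (n := 2)) ?nnegrE ?enorm_ge0// sqr_enorm r1 expr1n.
  rewrite (_ : S = f 1%:M @^-1` [set 1]); last first.
    by apply/seteqP; split=> r; rewrite /S /f/= mul1mx.
  by apply: closed_comp => [r _|]; [exact: cf|exact: closed_eq].
have S0 : S !=set0.
  exists (delta_mx 0 (Ordinal n0)).
  rewrite /S/= /dotv (bigD1 (Ordinal n0))//= big1 => [|i i0].
    by rewrite !mxE !eqxx mul1r addr0.
  by rewrite !mxE (negbTE i0) mulr0.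
have [v vS vmax] := EVT_max_rV S0 cS (continuous_subspaceT (cf A)).
have v1 : dotv v^T v^T = 1 by rewrite inE in vS.
exists v^T; first by rewrite -dotvv_eq0 v1 oner_eq0.
move=> w; rewrite v1 mulr1.
have [->|w0] := eqVneq w 0.
  by rewrite mulmx0 dotv0 mulr0.
have w_gt0 : 0 < dotv w w by rewrite lt_neqAle dotvv_ge0 eq_sym dotvv_eq0 w0.
pose r := (enorm w)^-1 *: w^T.
have e2 : (enorm w)^-1 * (enorm w)^-1 * dotv w w = 1.
  by rewrite -sqr_enorm -expr2 -exprMn mulVf ?expr1n// enorm_eq0.
have rS : r \in S.
  by rewrite inE /S/= /r linearZ/= trmxK dotvZl dotvZr mulrA.
have := vmax _ rS; rewrite /f /r linearZ/= trmxK -scalemxAr dotvZl dotvZr mulrA => h.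
rewrite -(ler_pM2l w_gt0) in h.
by move: h; rewrite mulrA (mulrC (dotv w w)) e2 mul1r mulrC.
Qed.

Lemma negative_definite_bound A : negative_definite A ->
  exists2 b : R, 0 < b & forall v, dotv v (A *m v) <= - b * dotv v v.
Proof.
move=> nA; have [n0|n_gt0] := posnP n.
  exists 1 => // v; rewrite [v](_ : _ = 0); last first.
    by apply/matrixP => i; have := ltn_ord i; rewrite {2}n0.
  by rewrite mulmx0 dotv0 mulr0.
have [v v0 vmax] := quadratic_form_max A n_gt0.
have v_gt0 : 0 < dotv v v by rewrite lt_neqAle dotvv_ge0 eq_sym dotvv_eq0 v0.
exists (- (dotv v (A *m v) / dotv v v)).
  by rewrite oppr_gt0 pmulr_llt0 ?invr_gt0// -dotv_mx nA.
by move=> w; rewrite opprK mulrAC ler_pdivlMr.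
Qed.

(** The maximum [mu] of the Rayleigh quotient of a symmetric matrix [A] is an
    eigenvalue: the form [mu - A] is nonnegative and vanishes at a maximizer
    [v], so that [v] is in its kernel. *)
Lemma symmetric_eigenvalue_bound A (alpha : R) : A \is symmetricmx ->
  (forall a : R, eigenvalue A a -> a <= - alpha) ->
  forall v, dotv v (A *m v) <= - alpha * dotv v v.
Proof.
move=> symA eigA.
have trA : A^T = A.
  move: symA; rewrite is_hermitianmxE expr0 scale1r => /eqP {2}->.
  by rewrite map_mx_id.
move=> w; have [n0|n_gt0] := posnP n.
  rewrite [w](_ : _ = 0); last first.
    by apply/matrixP => i; have := ltn_ord i; rewrite {2}n0.
  by rewrite mulmx0 dotv0 mulr0.
have [v v0 vmax] := quadratic_form_max A n_gt0.
have v_gt0 : 0 < dotv v v by rewrite lt_neqAle dotvv_ge0 eq_sym dotvv_eq0 v0.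
pose mu := dotv v (A *m v) / dotv v v.
have Amu x : dotv x (A *m x) <= mu * dotv x x.
  by rewrite /mu mulrAC ler_pdivlMr.
rewrite (le_trans (Amu w))// ler_wpM2r ?dotvv_ge0//; apply: eigA.
have [d dE] : exists d, d = mu *: v - A *m v by eexists.
have dvE x : dotv x (mu *: x - A *m x) = mu * dotv x x - dotv x (A *m x).
  by rewrite dotvDr dotvZr -scaleN1r dotvZr mulN1r.
have dv0 : dotv v d = 0 by rewrite dE dvE /mu divfK ?subrr ?gt_eqF.
pose q := dotv d (mu *: d - A *m d).
have q0 : 0 <= q.
  by rewrite /q dvE subr_ge0.
(* the nonnegative quadratic [t |-> (v - t d)^T (mu - A) (v - t d)] has no
   constant term, so its linear coefficient [- 2 |d|^2] vanishes *)
have dd (t : R) : 2 * t * dotv d d <= t ^+ 2 * q.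
  have := Amu (v - t *: d); rewrite -subr_ge0.
  rewrite -dvE.
  have -> : mu *: (v - t *: d) - A *m (v - t *: d) =
      d - t *: (mu *: d - A *m d).
    rewrite mulmxBr -scalemxAr; move: (A *m d) => Ad.
    by rewrite dE; apply/matrixP => i j; rewrite !mxE; ring.
  have ve : dotv v (mu *: d - A *m d) = dotv d d.
    rewrite dotvDr dotvZr dv0 mulr0 add0r -scaleN1r dotvZr dotv_trmx trA.
    have -> : A *m v = mu *: v - d by rewrite dE subKr.
    by rewrite mulN1r dotvDl dotvZl dv0 mulr0 add0r -(scaleN1r d) dotvZl mulN1r opprK.
  rewrite -!scaleNr dotvDr !dotvDl !dotvZr !dotvZl dv0 ve -/q.
  lra.
have d0 : dotv d d = 0.
  apply/eqP; rewrite eq_le dotvv_ge0 andbT leNgt; apply/negP => d_gt0.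
  have q1 : 0 < q + 1 by rewrite ltr_wpDl.
  have := dd ((q + 1)^-1 * dotv d d).
  rewrite -subr_ge0 (_ : _ - _ = - ((q + 1)^-1 ^+ 2 * dotv d d ^+ 2 * (q + 2))); last first.
    by field; rewrite gt_eqF.
  rewrite oppr_ge0 leNgt !mulr_gt0 ?exprn_gt0 ?invr_gt0// ltr_wpDl//.
apply/eigenvalueP; exists v^T; last by rewrite trmx_eq0.
apply: trmx_inj; rewrite trmx_mul !trmxK trA linearZ/= trmxK.
by apply/eqP; rewrite eq_sym -subr_eq0 -dE -dotvv_eq0 d0.
Qed.
End euclidean.

(** * Matrix exponential *)

Lemma cvg_sumr (R : realType) (T : Type) (F : set_system T) (n : nat)
    (f : 'I_n -> T -> R) (a : 'I_n -> R) : Filter F ->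
  (forall i, f i x @[x --> F] --> a i) ->
  \sum_(i < n) f i x @[x --> F] --> \sum_(i < n) a i.
Proof.
move=> FF fa; apply: (@cvg_big _ _ _ _ _ _ _ _ _ f) => //.
exact: add_continuous.
Qed.

Section matrix_exponential.
Variables (R : realType) (n : nat).
Implicit Types (C : 'M[R]_n) (t : R).

Lemma cvg_mx (m p : nat) (T : Type) (F : set_system T)
    (f : T -> 'M[R]_(m, p)) (l : 'M[R]_(m, p)) : Filter F ->
  (forall i j, f x i j @[x --> F] --> l i j) -> f x @[x --> F] --> l.
Proof.
move=> FF fl; apply/cvgrPdist_le => /= e e0.
near=> x.
rewrite [leLHS]/Num.Def.normr/= mx_normrE (bigmax_le _ (ltW e0))//= => i _.
rewrite !mxE/=.
move: i; near: x; apply: filter_forall => /= i.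
by have /cvgrPdist_le/(_ _ e0) := fl i.1 i.2.
Unshelve. all: by end_near. Qed.

Lemma exprZmx C t k : (t *: C) ^+ k = t ^+ k *: C ^+ k.
Proof.
elim: k => [|k IH]; first by rewrite !expr0 scale1r.
rewrite exprS IH (exprS C) (exprS t).
by rewrite [LHS](_ : _ = (t *: C) *m (t ^+ k *: C ^+ k))// -scalemxAl -scalemxAr scalerA.
Qed.

Definition expmx_coeff C i j : R^nat := fun k => k`!%:R^-1 * (C ^+ k) i j.

Lemma pseries_diffs_expmx_coeff C i j :
  pseries_diffs (expmx_coeff C i j) = fun k => k`!%:R^-1 * (C ^+ k.+1) i j.
Proof.
apply/funext => k; rewrite /pseries_diffs /expmx_coeff factS natrM invfM.
by rewrite !mulrA divff ?mul1r// pnatr_eq0.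
Qed.

Lemma exprmx_bounded C :
  exists2 M : R, 0 <= M & forall k i j, `|(C ^+ k) i j| <= M ^+ k.
Proof.
pose M := \sum_(i < n) \sum_(j < n) `|C i j|.
have M0 : 0 <= M by apply: sumr_ge0 => i _; apply: sumr_ge0.
exists M => //; elim=> [|k IH] i j.
  by rewrite !expr0 [in leLHS](_ : 1 = 1%:M)// mxE; case: (i == j); rewrite ?normr1 ?normr0.
rewrite exprS [in leLHS](_ : C * C ^+ k = C *m C ^+ k)// mxE.
rewrite (le_trans (ler_norm_sum _ _ _))// exprS.
apply: (@le_trans _ _ (\sum_(l < n) `|C i l| * M ^+ k)).
  by apply: ler_sum => l _; rewrite normrM ler_wpM2l.
rewrite -mulr_suml; apply: ler_wpM2r; first exact: exprn_ge0.
rewrite /M [leRHS](bigD1 i)//= lerDl.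
by apply: sumr_ge0 => l _; apply: sumr_ge0.
Qed.

Lemma is_cvg_pseries_exp_bound (a : R^nat) (K M t : R) : 0 <= K -> 0 <= M ->
  (forall k, `|a k| <= K * (M ^+ k / k`!%:R)) -> cvgn (pseries a t).
Proof.
move=> K0 M0 aKM; apply: normed_cvg.
apply: (@series_le_cvg _ _ (K *: exp_coeff (M * `|t|))).
- by move=> k /=; exact: normr_ge0.
- move=> k; rewrite /exp_coeff /= mulr_ge0//= mulr_ge0 ?exprn_ge0 ?invr_ge0 ?ler0n//.
  exact: mulr_ge0.
- move=> k; rewrite /= /GRing.scale/= normrM normrX (le_trans (ler_wpM2r _ (aKM k))) ?exprn_ge0//.
  by rewrite /exp_coeff /= exprMn -mulrA [_ * _ * `|t| ^+ k]mulrAC.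
- exact/is_cvg_seriesZ/is_cvg_series_exp_coeff.
Qed.

Lemma is_cvg_pseries_expmx C (m : nat) i j t :
  cvgn (pseries (fun k => k`!%:R^-1 * (C ^+ (m + k)) i j) t).
Proof.
have [M M0 CM] := exprmx_bounded C.
apply: (@is_cvg_pseries_exp_bound _ (M ^+ m) M) => //; first exact: exprn_ge0.
move=> k; rewrite normrM ger0_norm ?invr_ge0 ?ler0n//.
by rewrite mulrA -exprD mulrC ler_wpM2r// invr_ge0 ler0n.
Qed.

Lemma expmx_pseries C t i j :
  expmx (t *: C) i j = limn (pseries (expmx_coeff C i j) t).
Proof.
pose l := (\matrix_(i, j) limn (pseries (expmx_coeff C i j) t) : 'M[R]_n).
suff -> : expmx (t *: C) = l by rewrite mxE.
apply: cvg_lim => //; apply: cvg_mx => {}i {}j; rewrite mxE.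
rewrite (_ : (fun x => _) = pseries (expmx_coeff C i j) t).
  exact: (@is_cvg_pseries_expmx C 0).
apply/funext => N; rewrite /pseries /series/= summxE; apply: eq_bigr => k _.
by rewrite exprZmx !mxE /expmx_coeff mulrAC mulrA.
Qed.

(** Each entry of [e^(t C)] is a power series in [t] whose coefficients are
    dominated by [M^k / k!], and the term-by-term derivative of this series is
    the corresponding entry of [C e^(t C)]. *)
Lemma is_derive_expmx C t i j :
  is_derive t 1 (fun r => expmx (r *: C) i j) ((C *m expmx (t *: C)) i j).
Proof.
rewrite (_ : (fun r => _) = fun r => limn (pseries (expmx_coeff C i j) r)); last first.
  by apply/funext => r; exact: expmx_pseries.
have -> : (C *m expmx (t *: C)) i j = limn (pseries (pseries_diffs (expmx_coeff C i j)) t).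
  rewrite mxE; under eq_bigr do rewrite expmx_pseries.
  apply/esym/cvg_lim => //.
  rewrite (_ : pseries _ _ = fun N => \sum_(k < n) C i k * pseries (expmx_coeff C k j) t N).
    apply: cvg_sumr => k; apply: cvgM; first exact: cvg_cst.
    exact: (@is_cvg_pseries_expmx C 0).
  apply/funext => N; rewrite /pseries /series/=.
  under [RHS]eq_bigr do rewrite mulr_sumr.
  rewrite exchange_big/=; apply: eq_bigr => k _.
  rewrite pseries_diffs_expmx_coeff exprS [C * C ^+ k](_ : _ = C *m C ^+ k)// mxE.
  rewrite mulr_sumr mulr_suml; apply: eq_bigr => l _.
  by rewrite /expmx_coeff mulrCA !mulrA.
pose K := `|t| + 1.
apply: (@pseries_snd_diffs _ _ K).
- exact: (@is_cvg_pseries_expmx C 0).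
- rewrite pseries_diffs_expmx_coeff; exact: (@is_cvg_pseries_expmx C 1).
- rewrite pseries_diffs_expmx_coeff (_ : pseries_diffs _ = fun k => k`!%:R^-1 * (C ^+ (2 + k)) i j).
    exact: is_cvg_pseries_expmx.
  apply/funext => k; rewrite /pseries_diffs factS natrM invfM.
  by rewrite !mulrA divff ?mul1r// pnatr_eq0.
- by rewrite /K [ltRHS]ger0_norm ?addr_ge0// ltrDl.
Qed.

Lemma expmx0 : expmx (0 : 'M[R]_n) = 1%:M.
Proof.
apply/matrixP => i j; rewrite -(scale0r 0) expmx_pseries.
apply/cvg_lim => //; rewrite -cvg_shiftS.
rewrite (_ : (fun k => _) = fun=> (1%:M : 'M[R]_n) i j); first exact: cvg_cst.
apply/funext => k; rewrite /pseries /series/= big_nat_recl// big1 ?addr0.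
  by rewrite /expmx_coeff !expr0 fact0 invr1 mul1r mulr1.
by move=> l _; rewrite expr0n mulr0.
Qed.

End matrix_exponential.

Lemma is_derive_cV (R : realType) (n : nat) (f : R -> 'cV[R]_n) (t : R) (v : 'cV[R]_n) :
  is_derive t 1 f v <-> forall i, is_derive t 1 (fun r => f r i 0) (v i 0).
Proof.
split=> [[df fv] i|fv].
  have dfi : derivable (fun r => f r i 0) t 1 by move/derivable_mxP : df.
  by split=> //; rewrite -fv derive_mx// mxE.
have df : derivable f t 1.
  by apply/derivable_mxP => i j; rewrite (ord1 j); have [] := fv i.
split=> //; rewrite derive_mx//; apply/matrixP => i j; rewrite mxE (ord1 j).
by have [_ ->] := fv i.
Qed.

Lemma is_derive_dotvv (R : realType) (n : nat) (f : R -> 'cV[R]_n) (t : R) (v : 'cV[R]_n) :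
  is_derive t 1 f v ->
  is_derive t 1 (fun r => dotv (f r) (f r)) (2 * dotv (f t) v).
Proof.
move=> /is_derive_cV fv.
rewrite (_ : (fun r => _) = \sum_(i < n) ((fun r => f r i 0) * (fun r => f r i 0))); last first.
  by apply/funext => r; rewrite fct_sumE.
rewrite (_ : 2 * _ = \sum_(i < n) (f t i 0 *: v i 0 + f t i 0 *: v i 0)).
  by apply: is_derive_sum => i; exact: is_deriveM.
by rewrite mulr_sumr; apply: eq_bigr => i _; rewrite /GRing.scale/= mulr_natl mulr2n.
Qed.

Section exponential_decay.
Variables (R : realType) (n : nat) (C : 'M[R]_n) (v : 'cV[R]_n).
Let z t := expmx (t *: C) *m v.

Lemma expmx_orbit0 : z 0 = v.
Proof. by rewrite /z scale0r expmx0 mul1mx. Qed.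

Lemma is_derive_expmx_orbit (t : R) : is_derive t 1 z (C *m z t).
Proof.
apply/is_derive_cV => i; rewrite /z mulmxA mxE.
rewrite (_ : (fun r => _) = \sum_(j < n) (fun r => expmx (r *: C) i j * v j 0)).
  apply: is_derive_sum => j.
  rewrite (_ : (fun r => _) = v j 0 *: (fun r => expmx (r *: C) i j)).
    rewrite [X in is_derive _ _ _ X]mulrC.
    by apply: is_deriveZ; exact: is_derive_expmx.
  by apply/funext => r /=; rewrite mulrC.
by apply/funext => r; rewrite fct_sumE mxE.
Qed.

(** [|z|^2 e^(2 alpha t)] is nonincreasing, where [z' = C z]. *)
Lemma expmx_orbit_decay (alpha t : R) : 0 <= t ->
  (forall w, dotv w (C *m w) <= - alpha * dotv w w) ->
  enorm (z t) <= expR (- alpha * t) * enorm v.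
Proof.
move=> t0 Calpha.
rewrite -(ler_pXn2r (n := 2)) ?nnegrE ?mulr_ge0 ?enorm_ge0 ?expR_ge0//.
rewrite exprMn !sqr_enorm -expRM_natl.
pose f : R -> R := (fun r => expR (2 * alpha * r)) * (fun r => dotv (z r) (z r)).
pose df (r : R) : R := expR (2 * alpha * r) *: (2 * dotv (z r) (C *m z r))
  + dotv (z r) (z r) *: (2 * alpha * expR (2 * alpha * r)).
have fdf (r : R) : is_derive r 1 f (df r).
  apply: is_deriveM; first exact: is_derive_expRM.
  exact/is_derive_dotvv/is_derive_expmx_orbit.
have [|c _ ft] := MVT_segment t0 (fun r _ => fdf r).
  by apply: derivable_within_continuous => r _; have [] := fdf r.
have : f t <= f 0.
  rewrite -subr_le0 ft mulr_le0_ge0 ?subr0//.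
  rewrite /df /GRing.scale/=; have := Calpha (z c).
  have := expR_gt0 (2 * alpha * c); nra.
have fE r : f r = expR (2 * alpha * r) * dotv (z r) (z r) by [].
rewrite !fE mulr0 expR0 mul1r expmx_orbit0 => fle.
rewrite -(ler_pM2l (expR_gt0 (2 * alpha * t))) mulrA -expRD.
by rewrite (_ : _ + _ = 0) ?expR0 ?mul1r//; ring.
Qed.

End exponential_decay.

(** * Borel versions of Lebesgue measurable functions *)

Section borel_version.
Variable R : realType.
Notation mu := (@lebesgue_measure R).

(** A Lebesgue measurable set is Borel up to a null set, and the countably many
    sublevel sets [f < q], [q] rational, determine [f]: outside a null set that
    serves all of them, [f] is Borel. *)
Lemma borel_version (f : R -> R) :
  measurable_fun (`[0, +oo[%classic : set (lebesgueType R)) f ->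
  exists2 h : R -> R, measurable_fun [set: R] h &
    {ae mu, forall t : R, 0 <= t -> h t = f t}.
Proof.
move=> mf; pose D : set R := `[0, +oo[%classic.
have XN (q : rat) : exists XN : set R * set R,
    [/\ measurable XN.1, mu.-negligible XN.2 &
        D `&` f @^-1` `]-oo, ratr q[ = XN.1 `|` XN.2].
  have mD : (wlength idfun)^*%mu.-cara.-measurable (D `&` f @^-1` `]-oo, (ratr q : R)[).
    apply: mf => //.
    by apply: sub_caratheodory; exact: measurable_itv.
  move: mD; rewrite -completed_caratheodory_measurable g_sigma_completed_algebra_genE.
  by move=> -[X mX [N nN XN]]; exists (X, N).
have {XN}[F FP] := choice XN.
have [e eP] : exists e : nat -> option rat, forall q, exists n, e n = Some q.
  by exists unpickle => q; exists (pickle q); exact: pickleK.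
have [Z [mZ Z0 FZ]] : mu.-negligible (\bigcup_(n : nat)
    (if e n is Some q then (F q).2 else set0)).
  apply: negligible_bigcup => n; case: (e n) => [q|]; last exact: negligible_set0.
  by have [] := FP q.
have FqZ q : (F q).2 `<=` Z.
  by move=> x Fx; have [k ek] := eP q; apply: FZ; exists k; rewrite ?ek.
have mDZ : measurable (D `\` Z) by apply: measurableD => //; exact: measurable_itv.
exists (f \_ (D `\` Z)); last first.
  exists Z; split=> // x /= h; apply: contrapT => nZ; apply: h => x0.
  by rewrite patchE mem_set//; split=> //; rewrite /D/= in_itv/= x0.
suff : measurable_fun (D `\` Z) f by move/(measurable_restrictT f mDZ).1.
move=> _; apply: (measurability _ (RGenInftyO.measurableE R)) => //.
move=> /= _ [_ [x ->] <-].
rewrite (_ : _ `&` _ = \bigcup_(q in [set q : rat | ratr q < x]) ((F q).1 `\` Z)); last first.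
  apply/seteqP; split=> [t [[Dt nZt]]/=|t [q /= qx [Fq nZt]]].
    rewrite in_itv/= => fx.
    have [q] := rat_in_itvoo fx; rewrite in_itv/= => /andP[fq qx].
    exists q => //; split=> //.
    have [_ _ FE] := FP q.
    have : (D `&` f @^-1` `]-oo, (ratr q : R)[) t by split=> //=; rewrite in_itv.
    by rewrite FE => -[//|/FqZ].
  have [_ _ FE] := FP q.
  have : (D `&` f @^-1` `]-oo, (ratr q : R)[) t by rewrite FE; left.
  move=> [Dt /=]; rewrite !in_itv/= => fq; split; first by split.
  exact: lt_trans fq _.
rewrite (_ : \bigcup_(q in _) _ = \bigcup_(q : rat) (if ratr q < x then (F q).1 `\` Z else set0)).
  apply: countable_bigcupT_measurable => // q; case: ifP => _ //.
  by apply: measurableD => //; have [] := FP q.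
apply/seteqP; split=> [t [q /= qx tq]|t [q _]]; first by exists q; rewrite ?qx.
by case: ifP => // qx tq; exists q.
Qed.

Lemma ae_completed (P : R -> Prop) : {ae mu, forall t, P t} ->
  {ae @completed_lebesgue_measure R, forall t, P t}.
Proof.
by move=> [Z [mZ Z0 PZ]]; exists Z; split=> //; exact: sub_caratheodory.
Qed.

(** The Borel-Lebesgue measure is the image of the completed one under the
    identity. *)
Lemma ge0_integral_completed (f : R -> R) : measurable_fun [set: R] f ->
  (forall t, 0 <= f t) ->
  (\int[mu]_t (f t)%:E = \int[@completed_lebesgue_measure R]_t (f t)%:E)%E.
Proof.
move=> mf f0.
have mid : measurable_fun (setT : set (lebesgueType R)) (idfun : lebesgueType R -> measurableTypeR R).
  by move=> _ A mA; rewrite setTI; exact: sub_caratheodory.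
have := ge0_integral_pushforward mid (@completed_lebesgue_measure R)
  (D := setT) (f := fun t => (f t)%:E).
rewrite preimage_setT => <- //.
- exact/measurable_EFinP.
- by move=> t _; rewrite lee_fin.
Qed.

(** The differentiation theorem for indefinite integrals concerns Borel
    functions; the absolute value of a Borel version of [f], extended by zero to
    negative times, can take over the role of a dominating function. *)
Lemma integrable_borel_bound (f : R -> R) :
  (@completed_lebesgue_measure R).-integrable `[0, +oo[%classic (fun t => (f t)%:E) ->
  exists g : R -> R, [/\ mu.-integrable setT (EFin \o g), forall t, 0 <= g t &
    {ae mu, forall t : R, 0 <= t -> f t <= g t}].
Proof.
move=> intf; have /integrableP[/measurable_EFinP mf foo] := intf.
have [h mh hf] := borel_version mf.
pose D : set R := `[0, +oo[%classic.
have mD : measurable D by exact: measurable_itv.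
pose g := (fun t => `|h t|) \_ D.
have mg : measurable_fun setT g.
  suff : measurable_fun D (fun t => `|h t|) by move/(measurable_restrictT _ mD).1.
  by apply: measurableT_comp => //; exact: measurable_funTS.
have g0 t : 0 <= g t by rewrite /g patchE; case: ifP.
exists g; split=> //.
  apply/integrableP; split; first exact/measurable_EFinP.
  under eq_integral => t _ do rewrite /= ger0_norm ?g0//.
  rewrite ge0_integral_completed//.
  rewrite (_ : (fun t => (g t)%:E) = (fun t => `|(h t)%:E|%E) \_ D); last first.
    by apply/funext => t; rewrite /g !patchE; case: ifP.
  rewrite -integral_mkcond.
  rewrite [X in (X < _)%E](_ : _ = (\int[@completed_lebesgue_measure R]_(t in D) `|(f t)%:E|)%E)//.
  pose T := lebesgueType R.
  have mDT : measurable (D : set T) by apply: sub_caratheodory.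
  have mhT : measurable_fun (D : set T) (fun t => `|(h t)%:E|%E).
    apply/measurable_EFinP; apply: measurableT_comp => //.
    by apply: measurable_funTS => _ A mA; apply: sub_caratheodory; apply: mh.
  have mfT : measurable_fun (D : set T) (fun t => `|(f t)%:E|%E).
    by apply/measurable_EFinP; exact: measurableT_comp.
  apply: (ge0_ae_eq_integral mDT mhT mfT).
  - by move=> t _; exact: abse_ge0.
  - by move=> t _; exact: abse_ge0.
  - move: (ae_completed hf) => -[Z [mZ Z0 hZ]]; exists Z; split=> // t /= nt.
    apply: hZ => /= ht; apply: nt => Dt; rewrite ht//.
    by move: Dt; rewrite /D/= in_itv/= andbT.
apply: filterS hf => t ht t0; rewrite /g patchE mem_set ?ht ?ler_norm//.
by rewrite /D/= in_itv/= t0.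
Qed.

End borel_version.

(** * Indefinite integrals *)

Section indefinite_integral.
Variable R : realType.
Notation mu := (@lebesgue_measure R).

Definition prim (h : R -> R) (t : R) : R := \int[mu]_(s in `[0, t]) h s.

Lemma prim0 h : prim h 0 = 0.
Proof. by rewrite /prim set_itv1 Rintegral_set1. Qed.

Lemma primB (h : R -> R) (p q : R) : 0 <= p -> p <= q ->
  mu.-integrable `[0, q] (EFin \o h) ->
  prim h q - prim h p = \int[mu]_(s in `]p, q]) h s.
Proof.
by move=> p0 pq ih; rewrite /prim Rintegral_itvB// bnd_simp.
Qed.

Lemma is_derive_prim (h : R -> R) : measurable_fun [set: R] h ->
  (forall b, mu.-integrable `[- b, b] (EFin \o h)) ->
  {ae mu, forall t : R, 0 < t -> is_derive t 1 (prim h) (h t)}.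
Proof.
move=> mh ih.
have lh : locally_integrable [set: R] h.
  split=> //; first exact: openT.
  move=> K _ cK; have [M [_ KM]] := compact_bounded cK.
  pose b := M + 1.
  have Kb : K `<=` `[- b, b]%classic.
    move=> x Kx; rewrite /= in_itv/= -ler_norml; apply: KM => //.
    by rewrite /b ltrDl.
  have /integrableP[_] := ih b.
  apply: le_lt_trans; apply: ge0_subset_integral => //.
  - exact: compact_measurable.
  - by apply/measurable_EFinP; apply: measurableT_comp => //; exact: measurable_funTS.
have ih0 y : mu.-integrable `[0, y] (EFin \o h).
  apply: integrableS (ih `|y|) => //.
  by apply: subset_itv; rewrite bnd_simp ?oppr_le0//; exact: ler_norm.
apply: filterS (FTC1 (a := BLeft 0) ih0 lh) => t ht t0.
have [|dt tE] := ht; first by rewrite lte_fin.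
apply: DeriveDef; first exact: dt.
by rewrite -tE derive1E.
Qed.

Variable g : R -> R.
Hypothesis ig : mu.-integrable [set: R] (EFin \o g).
Hypothesis g0 : forall t, 0 <= g t.

Let ig_itv (i : interval R) : mu.-integrable [set` i] (EFin \o g).
Proof. by apply: integrableS ig. Qed.

Lemma prim_le p q : 0 <= p -> p <= q -> prim g p <= prim g q.
Proof.
move=> p0 pq; rewrite -subr_ge0 primB//.
by apply: Rintegral_ge0.
Qed.

Lemma prim_bounded : exists2 K : R, 0 <= K & forall t, prim g t <= K.
Proof.
exists (\int[mu]_s g s); first exact: Rintegral_ge0.
move=> t; rewrite /prim /Rintegral fine_le//.
- by apply: integrable_fin_num.
- by apply: integrable_fin_num.
- apply: ge0_subset_integral => //; first by have /integrableP[] := ig.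
  by move=> x _; rewrite lee_fin.
Qed.

(** The total length of the intervals is the measure of their union, to which
    the absolute continuity of the integral applies. *)
Lemma prim_uac (e : R) : 0 < e -> exists2 d : R, 0 < d &
  forall (m : nat) (p q : 'I_m -> R),
    (forall k, 0 <= p k /\ p k < q k) ->
    trivIset setT (fun k => `]p k, q k[%classic) ->
    \sum_(k < m) (q k - p k) < d ->
    \sum_(k < m) (prim g (q k) - prim g (p k)) < e.
Proof.
move=> e0; have [d [d0 dP]] := integral_normr_continuous ig e0.
exists d => // m p q pq tpq spq.
pose A := \big[setU/set0]_(k < m) `]p k, q k[%classic.
have mA : measurable A by apply: bigsetU_measurable.
have muA : mu A = (\sum_(k < m) (q k - p k))%:E.
  rewrite measure_bigsetU_ord// -sumEFin; apply: eq_bigr => k _.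
  have := lebesgue_measure_itv `]p k, q k[; rewrite /= lte_fin.
  by have [_ ->] := pq k => ->; rewrite -EFinB.
have muAd : (mu A < d%:E)%E by rewrite muA lte_fin.
apply: le_lt_trans (dP A mA muAd).
rewrite le_eqVlt; apply/orP; left; apply/eqP/EFin_inj.
rewrite /Rintegral fineK; last first.
  by apply: integrable_fin_num => //; apply: integrableS (integrable_abse ig).
have mg : measurable_fun A (fun x => `|g x|%:E).
  apply/measurable_EFinP; apply: measurableT_comp => //; apply: measurable_funTS.
  by have /integrableP[/measurable_EFinP] := ig.
rewrite /A ge0_integral_bigsetU//=.
- rewrite -sumEFin; apply: eq_bigr => k _; have [p0 pqk] := pq k.
  rewrite primB//; last exact: ltW.
  rewrite -(Rintegral_itv_bndo_bndc (ig_itv _)) /Rintegral fineK; last first.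
    exact: integrable_fin_num.
  by apply: eq_integral => x _; rewrite ger0_norm.
- exact: index_enum_uniq.
- by move: tpq; apply: sub_trivIset.
Qed.

Lemma ac_prim a b : 0 <= a -> ac (fun p q => prim g q - prim g p) a b.
Proof.
move=> a0 e /prim_uac[d d0 dP]; exists d => // m p q pq; apply: dP => k.
by have [ap [? _]] := pq k; rewrite (le_trans a0).
Qed.

Lemma prim_near (e : R) : 0 < e -> exists2 d : R, 0 < d &
  forall p q, 0 <= p -> p <= q -> q - p < d -> prim g q - prim g p < e.
Proof.
move=> e0; have [d d0 dP] := prim_uac e0; exists d => // p q p0.
rewrite le_eqVlt => /predU1P[->|pq qpd]; first by rewrite !subrr.
have := dP 1%N (fun=> p) (fun=> q); rewrite !big_ord1; apply => //.
by apply/trivIsetP => i j _ _; rewrite (ord1 i) (ord1 j).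
Qed.

End indefinite_integral.

Section dominated_primitives.
Variables (R : realType) (g : R -> R) (K : R).
Notation mu := (@lebesgue_measure R).
Hypothesis ig : mu.-integrable [set: R] (EFin \o g).
Hypothesis g0 : forall t, 0 <= g t.
Hypothesis K0 : 0 <= K.

(** A common modulus of continuity for the primitives of all functions that are
    bounded by [g + K]. *)
Definition prim_bound (t : R) : R := prim g t + K * t.

Lemma prim_bound_near (e : R) : 0 < e -> exists2 d : R, 0 < d &
  forall p q, 0 <= p -> p <= q -> q - p < d -> prim_bound q - prim_bound p < e.
Proof.
move=> e0; have e20 : 0 < e / 2 by rewrite divr_gt0.
have [d d0 dP] := prim_near ig g0 e20.
exists (Num.min d (e / 2 / (K + 1))).
  by rewrite lt_min d0 !divr_gt0// ltr_wpDl.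
move=> p q p0 pq; rewrite lt_min => /andP[/(dP _ _ p0 pq) Gd].
rewrite ltr_pdivlMr ?ltr_wpDl// => qpe; rewrite /prim_bound.
have : K * (q - p) <= (q - p) * (K + 1).
  by rewrite mulrC ler_wpM2l ?subr_ge0// lerDl.
lra.
Qed.

Lemma ac_prim_bound a b : 0 <= a ->
  ac (fun p q => prim_bound q - prim_bound p) a b.
Proof.
move=> a0; have acK : ac (fun p q : R => K * (q - p)) a b.
  by apply: (@ac_lipschitz _ _ _ _ K).
apply: (@ac_le _ _ _ _ _ _ 1 ler01 (ac_prim ig g0 _ a0) acK) => p q _ _ _.
by rewrite /prim_bound mul1r; lra.
Qed.

Let iK a b : mu.-integrable `[a, b] (EFin \o (fun=> K)).
Proof.
apply/integrableP; split; first exact/measurable_EFinP.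
under eq_integral do rewrite /=.
rewrite integral_cst// [X in (_ * X)%E](lebesgue_measure_itv `[a, b])/= -EFinD.
by case: ifP => _; rewrite ?mule0// -EFinM ltry.
Qed.

Lemma integrable_bound_itv a b : mu.-integrable `[a, b] (EFin \o (fun t => g t + K)).
Proof.
rewrite (_ : EFin \o _ = ((EFin \o g) \+ (EFin \o (fun=> K)))%E)//.
by apply: integrableD => //; apply: integrableS ig.
Qed.

Section one_function.
Variable f : R -> R.
Hypothesis mf : measurable_fun [set: R] f.
Hypothesis fg : forall t, `|f t| <= g t + K.

Lemma dominated_integrable_itv a b : mu.-integrable `[a, b] (EFin \o f).
Proof.
apply: le_integrable (integrable_bound_itv a b) => //.
  by apply/measurable_EFinP; exact: measurable_funTS.
move=> t _ /=; rewrite lee_fin (le_trans (fg t))//.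
by rewrite ler_norm.
Qed.

Lemma prim_incr p q : 0 <= p -> p <= q ->
  `|prim f q - prim f p| <= prim_bound q - prim_bound p.
Proof.
move=> p0 pq.
have sub : `]p, q] `<=` `[p, q] by exact: subset_itv_oc_cc.
have ifpq : mu.-integrable `]p, q] (EFin \o f).
  by apply: integrableS (dominated_integrable_itv p q).
have igKpq : mu.-integrable `]p, q] (EFin \o (fun t => g t + K)).
  by apply: integrableS (integrable_bound_itv p q).
rewrite primB//; last exact: dominated_integrable_itv.
rewrite (le_trans (le_normr_Rintegral _ _))//.
apply: (@le_trans _ _ (\int[mu]_(t in `]p, q]) (g t + K))).
  apply: le_Rintegral => //.
  by have := integrable_abse ifpq.
rewrite RintegralD//; last 2 first.
- by apply: integrableS ig.
- by apply: integrableS (iK p q).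
rewrite Rintegral_cst// [X in fine X](lebesgue_measure_itv `]p, q])/= lte_fin.
rewrite -primB//; last by apply: integrableS ig.
rewrite /prim_bound; move: pq; rewrite le_eqVlt => /predU1P[->|->]; first by rewrite ltxx mulr0; lra.
by rewrite -EFinB /=; lra.
Qed.

Lemma prim_abs t : 0 <= t -> `|prim f t| <= prim_bound t.
Proof.
move=> t0; have := prim_incr (lexx 0) t0.
by rewrite /prim_bound mulr0 !prim0 !addr0 !subr0.
Qed.
End one_function.
End dominated_primitives.

(** * Equicontinuous sequences *)

(** Limits along an ultrafilter on the indices exist pointwise by compactness
    and inherit the modulus of continuity [W]; finitely many points control
    the distance to the limit on [[0, m]], which leaves a set of indices in
    the ultrafilter. *)
Lemma equicontinuous_subsequence (R : realType) (n : nat)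
    (F : nat -> 'I_n -> R -> R) (W : R -> R) :
  (forall k i p q, 0 <= p -> p <= q -> `|F k i q - F k i p| <= W q - W p) ->
  (forall k i t, 0 <= t -> `|F k i t| <= W t) ->
  (forall e : R, 0 < e -> exists2 d : R, 0 < d &
     forall p q, 0 <= p -> p <= q -> q - p < d -> W q - W p < e) ->
  exists (y : 'I_n -> R -> R) (ka : nat -> nat), (forall m, (m <= ka m)%N) /\
    forall m i t, 0 <= t -> t <= m%:R -> `|F (ka m) i t - y i t| <= m.+1%:R^-1.
Proof.
move=> FW Fb Wnear.
have [U [UU Uoo]] := ultraFilterLemma eventually_filter.
have lim_ex (it : 'I_n * R) : exists l : R,
    0 <= it.2 -> F k it.1 it.2 @[k --> U] --> l.
  case: it => i t /=; have [t0|] := boolP (0 <= t); last by exists 0.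
  have [|l [_ Ul]] := @segment_compact _ (- W t) (W t) (F x i t @[x --> U]).
  - apply: (@filterS _ U _ setT) => [k _|]; last exact: filterT.
    by rewrite /= in_itv/= -ler_norml Fb.
  - exists l => _ B lB; have [//|UnB] := in_ultra_setVsetC ((fun k => F k i t) @^-1` B) UU.
    by have [x [nBx Bx]] := Ul (~` B) B UnB lB.
have {lim_ex}[l lP] := choice lim_ex.
pose y i t := l (i, t).
have yP i t : 0 <= t -> F k i t @[k --> U] --> y i t by exact: (lP (i, t)).
have yW i p q : 0 <= p -> p <= q -> `|y i q - y i p| <= W q - W p.
  move=> p0 pq.
  have cy : `|F k i q - F k i p| @[k --> U] --> `|y i q - y i p|.
    by apply: cvg_norm; apply: cvgB; apply: yP => //; exact: le_trans pq.
  apply: (cvgr_to_le cy).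
  by apply: nearW => k; exact: FW.
exists y.
suff exk m : exists k : nat, (m <= k)%N /\
    forall i t, 0 <= t -> t <= m%:R -> `|F k i t - y i t| <= m.+1%:R^-1.
  have [ka kaP] := choice exk.
  by exists ka; split=> m; have [] := kaP m.
pose e : R := m.+1%:R^-1 / 3.
have e0 : 0 < e by rewrite divr_gt0// invr_gt0.
have [d d0 Wd] := Wnear e e0.
pose h := d / 2; have h0 : 0 < h by rewrite divr_gt0.
pose L := (Num.truncn (m%:R / h)).+1.
have near_grid : \forall k \near U, forall ij : 'I_n * 'I_L,
    `|F k ij.1 (ij.2%:R * h) - y ij.1 (ij.2%:R * h)| < e.
  apply: filter_forall => -[i j] /=.
  have := yP i (j%:R * h) (mulr_ge0 (ler0n _ _) (ltW h0)).
  by move/cvgrPdist_lt => /(_ e e0); under eq_near do rewrite distrC.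
have near_m : \forall k \near U, (m <= k)%N.
  by apply: Uoo; exists m.
have [k [mk gk]] := @filter_ex _ U _ _ (filterI near_m near_grid).
exists k; split=> // i t t0 tm.
pose j := Num.truncn (t / h).
have th0 : 0 <= t / h by rewrite divr_ge0// ltW.
have jL : (j < L)%N.
  by rewrite /L ltnS; apply: le_truncn; rewrite ler_wpM2r// invr_ge0 ltW.
have /andP[jt tj] := truncn_itv th0.
have {}jt : j%:R * h <= t by rewrite -ler_pdivlMr.
have {}tj : t - j%:R * h < d.
  move: tj; rewrite ltr_pdivrMr// -natr1 mulrDl mul1r => tj.
  have hd : h <= d by rewrite /h; lra.
  by rewrite ltrBlDl (lt_le_trans tj)// lerD2l.
have jh0 : 0 <= j%:R * h by rewrite mulr_ge0// ltW.
have h1 := FW k i _ _ jh0 jt; have h2 := yW i _ _ jh0 jt.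
have h3 := gk (i, Ordinal jL); have h4 := Wd _ _ jh0 jt tj.
rewrite /= in h3.
have -> : F k i t - y i t = (F k i t - F k i (j%:R * h)) +
  (F k i (j%:R * h) - y i (j%:R * h)) - (y i t - y i (j%:R * h)) by ring.
rewrite (le_trans (ler_normB _ _))//.
have := ler_normD (F k i t - F k i (j%:R * h)) (F k i (j%:R * h) - y i (j%:R * h)).
have -> : m.+1%:R^-1 = e + e + e :> R by rewrite /e; field.
lra.
Qed.

(** * Carathéodory existence theorem *)

Lemma abs_continuousE (R : realType) (n : nat) (a b : R) (x : R -> 'cV[R]_n) :
  abs_continuous a b x = ac (fun p q => enorm (x q - x p)) a b.
Proof. by []. Qed.

Section caratheodory.
Variables (R : realType) (n : nat) (g : R -> R) (K : R) (x0 : 'cV[R]_n).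
Notation mu := (@lebesgue_measure R).
Hypothesis ig : mu.-integrable [set: R] (EFin \o g).
Hypothesis g0 : forall t, 0 <= g t.
Hypothesis K0 : 0 <= K.

Section euler.
Variable Phi : 'cV[R]_n -> 'I_n -> R -> R.
Hypothesis mPhi : forall v i, measurable_fun [set: R] (Phi v i).
Hypothesis Phig : forall v i t, `|Phi v i t| <= g t + K.

(** The state is frozen on each interval of the mesh [1 / (k + 1)], so that only
    the measurability of [t |-> Phi v i t] for a fixed [v] enters the
    definition. *)
Fixpoint euler_node (k j : nat) : 'cV[R]_n :=
  if j is j'.+1 then
    euler_node k j' + \col_i (\int[mu]_(s in `](j'%:R / k.+1%:R), (j%:R / k.+1%:R)[)
                                Phi (euler_node k j') i s)
  else x0.

(** [Num.truncn (s * (k + 1))] is the index of the node at the left of [s]: this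
    is the velocity of the [k]th Euler polygon at time [s]. *)
Definition euler_field (k : nat) (i : 'I_n) (s : R) : R :=
  Phi (euler_node k (Num.truncn (s * k.+1%:R))) i s.

Lemma euler_field_bound k i s : `|euler_field k i s| <= g s + K.
Proof. exact: Phig. Qed.

Lemma measurable_euler_field k i : measurable_fun [set: R] (euler_field k i).
Proof.
move=> _ A mA; rewrite setTI.
pose E (j : nat) := [set s : R | Num.truncn (s * k.+1%:R) = j].
have k0 : 0 < k.+1%:R :> R by [].
have mE j : measurable (E j).
  case: j => [|j].
    rewrite (_ : E 0%N = `]-oo, (k.+1%:R^-1)[%classic); first exact: measurable_itv.
    apply/seteqP; split=> s; rewrite /E /= in_itv/= -[k.+1%:R^-1]mul1r ltr_pdivlMr// ltNge.
      by move/truncn0Pn.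
    by move=> s1; apply/truncn0Pn.
  rewrite (_ : E j.+1 = `[(j.+1%:R / k.+1%:R), (j.+2%:R / k.+1%:R)[%classic); first exact: measurable_itv.
  apply/seteqP; split=> s; rewrite /E /= in_itv/=.
    move=> sj; rewrite ler_pdivrMr// ltr_pdivlMr// -sj truncn_itv//.
    by rewrite (le_trans ler01)// -truncn_gt0 sj.
  rewrite ler_pdivrMr// ltr_pdivlMr// => sj; apply/eqP; rewrite truncn_eq//.
  by case/andP: sj => sj _; rewrite (le_trans _ sj).
rewrite (_ : _ @^-1` A = \bigcup_j (E j `&` Phi (euler_node k j) i @^-1` A)).
  apply: bigcupT_measurable => j; apply: measurableI => //.
  by rewrite -[X in measurable X]setTI; exact: mPhi.
apply/seteqP; split=> [s As|s [j _ [<- //]]].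
by exists (Num.truncn (s * k.+1%:R)).
Qed.

Lemma euler_nodeE k j i :
  euler_node k j i 0 = x0 i 0 + prim (euler_field k i) (j%:R / k.+1%:R).
Proof.
have k0 : 0 < k.+1%:R :> R by [].
have iE a b : mu.-integrable `[a, b] (EFin \o euler_field k i).
  exact: (dominated_integrable_itv ig (measurable_euler_field k i) (euler_field_bound k i)).
elim: j => [|j IH]; first by rewrite mul0r prim0 addr0.
have j0 : 0 <= j%:R / k.+1%:R :> R by rewrite divr_ge0.
have jj : j%:R / k.+1%:R <= j.+1%:R / k.+1%:R :> R.
  by rewrite ler_wpM2r ?invr_ge0// ler_nat.
rewrite [LHS]/= 2!mxE IH -addrA; congr (_ + _).
apply/esym/eqP; rewrite [eqbRHS]addrC -subr_eq; apply/eqP.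
rewrite primB// -Rintegral_itv_bndo_bndc; last first.
  by apply: integrableS (iE (j%:R / k.+1%:R) (j.+1%:R / k.+1%:R)) => //; apply: subset_itv_oo_cc.
apply: eq_Rintegral => s; rewrite inE /= in_itv/= => /andP[js sj].
rewrite /euler_field (_ : Num.truncn _ = j)//.
apply/eqP; rewrite truncn_eq.
  by rewrite -ler_pdivrMr// (ltW js)/= -ltr_pdivlMr.
by rewrite mulr_ge0// (le_trans j0)// ltW.
Qed.

(** The nodes at the left of [s] converge to the limit of the polygons at
    [s], since the mesh tends to zero. *)
Lemma cvg_euler_node (y : 'I_n -> R -> R) (ka : nat -> nat) (s : R) : 0 <= s ->
  (forall m, (m <= ka m)%N) ->
  (forall m i t, 0 <= t -> t <= m%:R ->
     `|prim (euler_field (ka m) i) t - y i t| <= m.+1%:R^-1) ->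
  euler_node (ka m) (Num.truncn (s * (ka m).+1%:R)) @[m --> \oo] -->
    x0 + \col_i y i s.
Proof.
move=> s0 kam Fy; apply: cvg_mx => i j; rewrite (ord1 j) !mxE.
apply/cvgrPdist_lt => e e0; have e20 : 0 < e / 2 by rewrite divr_gt0.
have [d d0 Wd] := prim_bound_near ig g0 K0 e20.
near=> m.
have k0 : 0 < (ka m).+1%:R :> R by [].
rewrite euler_nodeE opprD addrACA subrr add0r.
set t := _ / _.
have /andP[ts st] := truncn_itv (mulr_ge0 s0 (ltW k0)).
have t0 : 0 <= t by rewrite divr_ge0.
have {}ts : t <= s by rewrite ler_pdivrMr.
have {}st : s - t < d.
  have std : s - t < (ka m).+1%:R^-1.
    by rewrite -(ltr_pM2r k0) mulrBl /t divfK ?gt_eqF// mulVf ?gt_eqF// ltrBlDr nat1r.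
  rewrite (lt_le_trans std)//; apply: (@le_trans _ _ m.+1%:R^-1).
    by rewrite lef_pV2 ?posrE// ler_nat ltnS.
  by apply: ltW; near: m; exact: (near_infty_natSinv_lt (PosNum d0)).
have := prim_incr ig (measurable_euler_field (ka m) i) (euler_field_bound (ka m) i) t0 ts.
have := Wd _ _ t0 ts st.
have sm : s <= m%:R by near: m; exact: nbhs_infty_ger.
have := Fy m i s s0 sm.
have : m.+1%:R^-1 < e / 2 :> R by near: m; exact: (near_infty_natSinv_lt (PosNum e20)).
move: (prim _ s) (prim _ t) => a b h1 h2 h3 h4.
rewrite (_ : y i s - b = (a - b) - (a - y i s)); last by ring.
by rewrite (le_lt_trans (ler_normB _ _))// [e]splitr ltrD// ?(le_lt_trans h4) ?(le_lt_trans h2).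
Unshelve. all: by end_near. Qed.

End euler.
Variable G : R -> 'cV[R]_n -> 'cV[R]_n.
Hypothesis Gmeas : forall v i, exists2 h : R -> R, measurable_fun [set: R] h &
  {ae mu, forall t : R, 0 <= t -> h t = G t v i 0}.
Hypothesis Gcont : {ae mu, forall t : R, 0 <= t -> continuous (G t)}.
Hypothesis Gbound : {ae mu, forall t : R, 0 <= t -> forall v i, `|G t v i 0| <= g t + K}.

Let mg : measurable_fun [set: R] g.
Proof. by have /integrableP[/measurable_EFinP] := ig. Qed.

Let gK0 t : 0 <= g t + K. Proof. exact: addr_ge0. Qed.

(** Clipping a Borel version at the level [g + K] makes the bound hold at every
    time instead of almost every time, so that all the integrals in the Euler
    scheme are defined and share one modulus of continuity. *)
Lemma clipped_version : exists Phi : 'cV[R]_n -> 'I_n -> R -> R, forall v i,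
  [/\ measurable_fun [set: R] (Phi v i), forall t, `|Phi v i t| <= g t + K &
      {ae mu, forall t : R, 0 <= t -> Phi v i t = G t v i 0}].
Proof.
suff clip (vi : 'cV[R]_n * 'I_n) : exists f : R -> R,
    [/\ measurable_fun [set: R] f, forall t, `|f t| <= g t + K &
      {ae mu, forall t : R, 0 <= t -> f t = G t vi.1 vi.2 0}].
  have [f fP] := choice clip; exists (fun v i => f (v, i)) => v i; exact: (fP (v, i)).
case: vi => v i /=; have [h mh hG] := Gmeas v i.
have mgK : measurable_fun [set: R] (fun t => g t + K) by exact: measurable_funD.
exists (fun t => Num.max (- (g t + K)) (Num.min (g t + K) (h t))); split.
- apply: (measurable_maxr (f := fun t => - (g t + K))); first exact: measurableT_comp.
  exact: measurable_minr.
- move=> t; have := gK0 t; rewrite ler_norml le_max lexx/= ge_max ge_min lexx andbT.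
  by move=> h0; rewrite (le_trans _ h0)// oppr_le0.
- apply: filterS2 hG Gbound => t ht Gt t0.
  have := Gt t0 v i; rewrite -ht// ler_norml => /andP[h1 h2].
  by rewrite (min_idPr h2) (max_idPr h1).
Qed.

(** A subsequence of the Euler polygons converges locally uniformly.  At almost
    every time the frozen states converge as well, and by continuity of [G t] so
    do the velocities; dominated convergence passes to the limit in the integral
    equation, which the differentiation theorem turns into the differential
    equation. *)
Theorem caratheodory_existence : exists x : R -> 'cV[R]_n,
  [/\ x 0 = x0, forall b, abs_continuous 0 b x &
      {ae mu, forall t : R, 0 <= t -> is_derive t 1 x (G t (x t))}].
Proof.
have [Phi PhiP] := clipped_version.
have mPhi v i : measurable_fun [set: R] (Phi v i) by have [] := PhiP v i.
have Phig v i t : `|Phi v i t| <= g t + K by have [] := PhiP v i.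
pose F k i := prim (euler_field Phi k i).
have mE k i : measurable_fun [set: R] (euler_field Phi k i).
  exact: measurable_euler_field.
have Eg k i t : `|euler_field Phi k i t| <= g t + K by exact: Phig.
have [y [ka [kam Fy]]] : exists (y : 'I_n -> R -> R) (ka : nat -> nat),
    (forall m, (m <= ka m)%N) /\
    forall m i t, 0 <= t -> t <= m%:R -> `|F (ka m) i t - y i t| <= m.+1%:R^-1.
  apply: (@equicontinuous_subsequence _ _ F (prim_bound g K)).
  - by move=> k i p q; exact: (prim_incr ig (mE k i) (Eg k i)).
  - by move=> k i t; exact: (prim_abs ig (mE k i) (Eg k i)).
  - exact: (prim_bound_near ig g0 K0).
pose xs s := x0 + \col_i y i s.
(* One null set serves all nodes, of which there are countably many. *)
have node_ae : {ae mu, forall t : R, forall k j i, 0 <= t ->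
    Phi (euler_node Phi k j) i t = G t (euler_node Phi k j) i 0}.
  apply: ae_foralln => k; apply: ae_foralln => j; apply: filter_forall => i.
  by have [] := PhiP (euler_node Phi k j) i.
have [Z [mZ Z0 goodZ]] : mu.-negligible (~` [set t : R | 0 <= t -> [/\ continuous (G t),
    forall v i, `|G t v i 0| <= g t + K &
    forall k j i, Phi (euler_node Phi k j) i t = G t (euler_node Phi k j) i 0]]).
  apply: filterS3 node_ae Gcont Gbound => t h1 h2 h3 t0.
  by split; [exact: h2|exact: h3|move=> k j i; exact: h1].
pose D : set R := `[0, +oo[%classic `\` Z.
have mD : measurable D by apply: measurableD => //; exact: measurable_itv.
have goodD t : D t -> [/\ continuous (G t),
    forall v i, `|G t v i 0| <= g t + K &
    forall k j i, Phi (euler_node Phi k j) i t = G t (euler_node Phi k j) i 0].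
  move=> [/= + nZ]; rewrite in_itv/= andbT => t0; apply: contrapT => nt; apply: nZ.
  by apply: goodZ => /= /(_ t0).
(* Cutting off outside [D] makes the velocities converge at every time, so that
   the limit is measurable. *)
pose h i := (fun s => G s (xs s) i 0) \_ D.
have cvgE i s : (euler_field Phi (ka m) i \_ D) s @[m --> \oo] --> h i s.
  rewrite /h patchE; have [|nDs] := boolP (s \in D); last first.
    under eq_fun do rewrite patchE (negbTE nDs).
    exact: cvg_cst.
  move=> Ds; under eq_fun do rewrite patchE Ds.
  move: Ds; rewrite inE => Ds; have [Gs _ Es] := goodD s Ds.
  rewrite /euler_field; under eq_fun do rewrite Es.
  have s0 : 0 <= s by move: Ds => -[/= + _]; rewrite in_itv/= andbT.
  have := @cvg_euler_node Phi mPhi Phig y ka s s0 kam Fy; rewrite -/(xs s) => cn.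
  have cG : G s (euler_node Phi (ka m) (Num.truncn (s * (ka m).+1%:R))) @[m --> \oo] --> G s (xs s).
    exact: (cvg_comp _ _ cn (Gs (xs s))).
  exact: (cvg_comp _ _ cG (@coord_continuous _ _ _ i 0 _)).
have mh i : measurable_fun [set: R] (h i).
  apply: (measurable_fun_cvg (h := fun m => euler_field Phi (ka m) i \_ D)).
    by move=> m; have := measurable_funS measurableT (@subsetT _ D) (mE (ka m) i);
      move/(measurable_restrictT _ mD).1.
  by move=> s _; exact: cvgE.
have hg i t : `|h i t| <= g t + K.
  rewrite /h patchE; case: ifPn => [|_]; last by rewrite normr0.
  by rewrite inE => /goodD[_ + _]; apply.
have yh i t : 0 <= t -> y i t = prim (h i) t.
  move=> t0; have it := dominated_integrable_itv ig (mE _ i) (Eg _ i).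
  have ih := dominated_integrable_itv ig (mh i) (hg i) 0 t.
  have mit : measurable (`[0, t]%classic : set R) by exact: measurable_itv.
  have cy : F (ka m) i t @[m --> \oo] --> y i t.
    apply/cvgrPdist_lt => e e0; near=> m.
    rewrite distrC (le_lt_trans (Fy m i t t0 _))//.
      by near: m; exact: nbhs_infty_ger.
    by near: m; exact: (near_infty_natSinv_lt (PosNum e0)).
  have ch : F (ka m) i t @[m --> \oo] --> prim (h i) t.
    rewrite /F /prim /Rintegral; apply: fine_cvg; rewrite fineK; last first.
      exact: integrable_fin_num.
    have [] := @dominated_convergence _ _ R mu `[0, t]%classic mit
      (fun m s => (euler_field Phi (ka m) i s)%:E) (fun s => (h i s)%:E) (fun s => (g s + K)%:E).
    - by move=> m; apply/measurable_EFinP; apply: measurable_funTS; exact: mE.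
    - by apply/measurable_EFinP; apply: measurable_funTS; exact: mh.
    - exists Z; split=> // s /= ns; apply: contrapT => nZs; apply: ns => st.
      have Ds : D s.
        by split=> //=; move: st; rewrite !in_itv/= => /andP[->].
      have := cvgE i s; under eq_fun do rewrite patchE mem_set//.
      by move=> cs; apply: cvg_EFin => //; exact: nearW.
    - exact: integrable_bound_itv.
    - by apply: aeW => s m _; rewrite lee_fin.
    - by [].
  exact: (cvg_unique _ cy ch).
exists (fun t => x0 + \col_i prim (h i) t).
have xE t : 0 <= t -> x0 + \col_i prim (h i) t = xs t.
  by move=> t0; congr (_ + _); apply/matrixP => i j; rewrite !mxE yh.
split.
- by apply/matrixP => i j; rewrite !mxE prim0 addr0 (ord1 j).
- move=> b; rewrite abs_continuousE; apply: (ac_le1 (K := n%:R) _ (ac_prim_bound ig g0 K0 b (lexx 0))) => //.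
  move=> p q p0 pq _; rewrite (le_trans (enorm_le_sum _))//.
  rewrite mulr_natl -[X in _ *+ X]card_ord -sumr_const; apply: ler_sum => i _.
  rewrite !mxE opprD addrACA subrr add0r.
  exact: (prim_incr ig (mh i) (hg i) p0 (ltW pq)).
- have hd : {ae mu, forall t : R, forall i : 'I_n, 0 < t -> is_derive t 1 (prim (h i)) (h i t)}.
    apply: filter_forall => i; apply: is_derive_prim => // b.
    exact: (dominated_integrable_itv ig (mh i) (hg i)).
  have nZ : {ae mu, forall t : R, ~ Z t /\ t != 0}.
    apply: filterI; first by exists Z; split=> // t /= /contrapT.
    exists [set 0]; split=> //; first exact: lebesgue_measure_set1.
    by move=> t /= /negP; rewrite negbK => /eqP.
  apply: filterS2 hd nZ => t ht [nZt t_neq0] t0.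
  have Dt : D t by split=> //=; rewrite in_itv/= t0.
  have t_gt0 : 0 < t by rewrite lt_neqAle eq_sym t_neq0.
  apply/is_derive_cV => i; rewrite xE//.
  have -> : G t (xs t) i 0 = h i t by rewrite /h patchE mem_set.
  rewrite (_ : (fun r => _) = (fun=> x0 i 0) + prim (h i)); last first.
    by apply/funext => r; rewrite !mxE.
  by rewrite -[h i t]add0r; apply: is_deriveD; exact: ht.
Unshelve. all: by end_near. Qed.

End caratheodory.

(** * A priori estimate for the closed loop *)

Lemma ac_coord (R : realType) (n : nat) (x : R -> 'cV[R]_n) (a b : R) (i : 'I_n) :
  ac (fun p q => enorm (x q - x p)) a b -> ac (fun p q => `|x q i 0 - x p i 0|) a b.
Proof.
move=> acx; apply: (ac_le1 ler01 acx) => p q _ _ _.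
by rewrite mul1r; have := enorm_coord (x q - x p) i; rewrite !mxE.
Qed.

Lemma ac_of_coord (R : realType) (n : nat) (x : R -> 'cV[R]_n) (a b : R) :
  (forall i, ac (fun p q => `|x q i 0 - x p i 0|) a b) ->
  ac (fun p q => enorm (x q - x p)) a b.
Proof.
move=> acx; apply: (ac_le1 ler01 (ac_sum acx)) => p q _ _ _.
rewrite mul1r (le_trans (enorm_le_sum _))//.
by apply: ler_sum => i _; rewrite !mxE.
Qed.

Lemma ac_dotvv (R : realType) (n : nat) (x : R -> 'cV[R]_n) (a b : R) : a <= b ->
  ac (fun p q => enorm (x q - x p)) a b ->
  ac (fun p q => `|dotv (x q) (x q) - dotv (x p) (x p)|) a b.
Proof.
move=> ab acx.
have := ac_sum (fun i => acM ab (ac_coord i acx) (ac_coord i acx)).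
move=> acS; apply: (ac_le1 ler01 acS) => p q _ _ _.
by rewrite mul1r -sumrB ler_norm_sum.
Qed.

Lemma monotone_bounded_tail (R : realType) (J : R -> R) (K e : R) : 0 < e ->
  (forall p q, 0 <= p -> p <= q -> J p <= J q) ->
  (forall t, 0 <= t -> J t <= K) ->
  exists2 s : R, 0 <= s & forall t, s <= t -> J t - J s < e.
Proof.
move=> e0 Jmono JK.
pose S := [set J t | t in [set t : R | 0 <= t]].
have hS : has_sup S by split; [exists (J 0); exists 0 => /=|exists K => _ [t /= t0 <-]; exact: JK].
have [_ [s /= s0 <-] sS] := sup_adherent e0 hS.
exists s => // t st; rewrite ltrBlDr -ltrBlDl (le_lt_trans _ sS)// lerD2r.
by apply: ub_le_sup; [case: hS|exists t => //=; exact: le_trans st].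
Qed.

Lemma near_expR_decay (R : realType) (k A e : R) : 0 < k -> 0 <= A -> 0 < e ->
  \forall t \near +oo, expR (- k * t) * A <= e.
Proof.
move=> k0 A0 e0; near=> t.
have tA : A / (e * k) <= t by near: t; exact: nbhs_pinfty_ge (num_real _).
have t0 : 0 <= t by rewrite (le_trans _ tA)// divr_ge0// mulr_ge0// ltW.
rewrite mulNr expRN mulrC ler_pdivrMr ?expR_gt0//.
move: tA; rewrite ler_pdivrMr ?mulr_gt0// => /le_trans; apply.
have := expR_ge1Dx (k * t); move: (expR _) => E hE.
by rewrite mulrC -mulrA ler_pM2l//; lra.
Unshelve. all: by end_near. Qed.

Section a_priori.
Variables (R : realType) (n : nat) (phi psi : R -> 'cV[R]_n -> 'cV[R]_n).
Variables (y0 : R -> 'cV[R]_n) (C B : 'M[R]_n) (xi0 u0 : 'cV[R]_n).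
Variables (alpha beta Y : R) (g : R -> R).
Notation mu := (@lebesgue_measure R).
Hypothesis alpha_gt0 : 0 < alpha.
Hypothesis beta_gt0 : 0 < beta.
Hypothesis Cdiss : forall v, dotv v (C *m v) <= - alpha * dotv v v.
Hypothesis Bdiss : forall v, dotv v (B *m v) <= - beta * dotv v v.
Hypothesis y0_ac : forall b, ac (fun p q => enorm (y0 q - y0 p)) 0 b.
Hypothesis y0_derive : {ae mu, forall t : R, 0 <= t -> is_derive t 1 y0 (psi t (y0 t))}.
Hypothesis y0_bound : forall t, 0 <= t -> enorm (y0 t) <= Y.
Hypothesis ig : mu.-integrable [set: R] (EFin \o g).
Hypothesis g0 : forall t, 0 <= g t.

(** The solution of [z' = C z] along which the state is steered towards [y0]. *)
Definition transient (t : R) : 'cV[R]_n := expmx (t *: C) *m (xi0 - y0 0).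
(** The reference motion [transient t + y0 t] stays in a ball of radius
    [radius - 1]; the margin of 1 is the room left for the deviation of the
    state from it. *)
Definition radius : R := enorm (xi0 - y0 0) + Y + 1.

Hypothesis bound_g : {ae mu, forall t : R, 0 <= t -> forall x, enorm x <= radius ->
  enorm (phi t x) <= g t /\ enorm (psi t x) <= g t}.

Let eta := xi0 - y0 0.
Let z := transient.
Let rho := radius.

Lemma Y_ge0 : 0 <= Y.
Proof. by rewrite (le_trans (enorm_ge0 (y0 0)))// y0_bound. Qed.

Lemma transient_decay t : 0 <= t -> enorm (z t) <= expR (- alpha * t) * enorm eta.
Proof. by move=> t0; exact: expmx_orbit_decay. Qed.

Lemma transient_bound t : 0 <= t -> enorm (z t) <= enorm eta.
Proof.
move=> t0; rewrite (le_trans (transient_decay t0))// ler_piMl ?enorm_ge0//.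
by rewrite -expR0 ler_expR mulNr oppr_le0 mulr_ge0// ltW.
Qed.

Lemma transient_ac b : ac (fun p q => enorm (z q - z p)) 0 b.
Proof.
have [K K0 CK] := enorm_mulmx_bounded C.
apply: ac_of_coord => i.
apply: (ac_bounded_derivative (df := fun t => (C *m z t) i 0) (K := K * enorm eta)) => t.
  by move=> _; have /is_derive_cV := is_derive_expmx_orbit C eta t; exact.
move=> /andP[t0 _]; rewrite (le_trans (enorm_coord _ _))// (le_trans (CK _))//.
by rewrite ler_pM2l// transient_bound.
Qed.

Section gain.
Variable Kc : R.
Hypothesis Kc_gt0 : 0 < Kc.
Hypothesis CK : forall v, enorm (C *m v) <= Kc * enorm v.

(** A bound for the scaled control, valid as long as the state stays in the
    ball of radius [radius]. *)
Definition state_bound : R := enorm u0 + enorm eta + Y + rho.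

(** The primitive of a bound for [2 v . w], where [v] is the scaled control and
    [w = C z + psi(t, y0) - phi(t, x)] the part of its velocity that does not
    come from [B].  It depends on neither [eps] nor the solution. *)
Definition forcing_budget (t : R) : R :=
  2 * state_bound * (2 * prim g t + Kc * enorm eta / alpha * (1 - expR (- alpha * t))).
Let J := forcing_budget.
Let M := state_bound.

Lemma radius_gt0 : 0 < rho.
Proof. by rewrite /rho /radius ltr_wpDl// addr_ge0 ?enorm_ge0 ?Y_ge0. Qed.

Lemma state_bound_gt0 : 0 < M.
Proof.
by rewrite /M /state_bound ltr_wpDl ?radius_gt0// !addr_ge0 ?enorm_ge0 ?Y_ge0.
Qed.

Let c : R := Kc * enorm eta / alpha.

Let c0 : 0 <= c.
Proof. by rewrite /c divr_ge0 ?mulr_ge0 ?enorm_ge0// ltW. Qed.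

Let expB_ge0 p q : p <= q -> 0 <= expR (- alpha * p) - expR (- alpha * q).
Proof.
by move=> pq; rewrite subr_ge0 ler_expR !mulNr lerN2 ler_pM2l.
Qed.

Let expB_le p q : 0 <= p -> p <= q ->
  expR (- alpha * p) - expR (- alpha * q) <= alpha * (q - p).
Proof.
move=> p0 pq.
have -> : expR (- alpha * q) = expR (- alpha * p) * expR (- alpha * (q - p)).
  by rewrite -expRD; congr expR; ring.
have e1 : expR (- alpha * p) <= 1.
  by rewrite -expR0 ler_expR mulNr oppr_le0 mulr_ge0// ltW.
have := expR_ge1Dx (- alpha * (q - p)).
have := expR_gt0 (- alpha * p); have : 0 <= alpha * (q - p).
  by rewrite mulr_ge0 ?subr_ge0// ltW.
move: (expR _) (expR _) e1 => a b a1; rewrite mulNr; nra.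
Qed.

Lemma forcing_budgetB p q : J q - J p = 2 * M * (2 * (prim g q - prim g p) +
  c * (expR (- alpha * p) - expR (- alpha * q))).
Proof. by rewrite /J /forcing_budget -/c -/M; ring. Qed.

Lemma forcing_budget_le p q : 0 <= p -> p <= q -> J p <= J q.
Proof.
move=> p0 pq; rewrite -subr_ge0 forcing_budgetB mulr_ge0//.
  by rewrite mulr_ge0// ltW// state_bound_gt0.
have := prim_le ig g0 p0 pq; rewrite -subr_ge0 => h.
by rewrite addr_ge0// mulr_ge0// expB_ge0.
Qed.

Lemma forcing_budget_bounded : exists K : R, forall t, 0 <= t -> J t <= K.
Proof.
have [K K0 gK] := prim_bounded ig g0.
exists (2 * M * (2 * K + c)) => t t0.
rewrite /J /forcing_budget -/c -/M ler_wpM2l ?mulr_ge0 ?(ltW state_bound_gt0)//.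
rewrite lerD// ?ler_wpM2l//.
by rewrite ler_piMr// lerBlDr lerDl expR_ge0.
Qed.

Lemma forcing_budget_near (e : R) : 0 < e -> exists2 d : R, 0 < d &
  forall p q, 0 <= p -> p <= q -> q - p < d -> J q - J p < e.
Proof.
move=> e0; have ca : 0 <= c * alpha / 2 by rewrite divr_ge0// mulr_ge0// ltW.
have e4 : 0 < e / (4 * M) by rewrite divr_gt0// mulr_gt0// state_bound_gt0.
have [d d0 dP] := prim_bound_near ig g0 ca e4.
exists d => // p q p0 pq /(dP _ _ p0 pq); rewrite forcing_budgetB /prim_bound.
rewrite ltr_pdivlMr ?mulr_gt0 ?state_bound_gt0// => h; apply: le_lt_trans h.
have := expB_le p0 pq => /(ler_wpM2l c0) h.
have : M * (c * (expR (- alpha * p) - expR (- alpha * q))) <= M * (c * (alpha * (q - p))).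
  by rewrite ler_pM2l// state_bound_gt0.
lra.
Qed.

Lemma forcing_budget_ac b : ac (fun p q => `|J q - J p|) 0 b.
Proof.
have ca : 0 <= c * alpha / 2 by rewrite divr_ge0// mulr_ge0// ltW.
apply: (ac_le1 (K := 4 * M) _ (ac_prim_bound ig g0 ca b (lexx 0))).
  by rewrite mulr_ge0// ltW// state_bound_gt0.
move=> p q p0 pq _; rewrite ger0_norm ?subr_ge0 ?forcing_budget_le ?(ltW pq)//.
rewrite forcing_budgetB /prim_bound.
have := expB_le p0 (ltW pq) => /(ler_wpM2l c0) h.
have : M * (c * (expR (- alpha * p) - expR (- alpha * q))) <= M * (c * (alpha * (q - p))).
  by rewrite ler_pM2l// state_bound_gt0.
lra.
Qed.

Lemma forcing_budget_derive : {ae mu, forall t : R, 0 < t ->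
  is_derive t 1 J (2 * M * (2 * g t + Kc * enorm eta * expR (- alpha * t)))}.
Proof.
have gi b : mu.-integrable `[- b, b] (EFin \o g) by apply: integrableS ig.
have mg : measurable_fun [set: R] g by have /integrableP[/measurable_EFinP] := ig.
apply: filterS (is_derive_prim mg gi) => t gt t0; have {}gt := gt t0.
have h1 := @is_deriveZ _ _ _ _ (2 : R) _ _ _ gt.
have h2 := is_deriveB (is_derive_cst (1 : R) t 1) (is_derive_expRM (- alpha) t).
have h3 := @is_deriveZ _ _ _ _ (2 * M) _ _ _ (is_deriveD h1 (@is_deriveZ _ _ _ _ c _ _ _ h2)).
rewrite (_ : 2 * M * _ = (2 * M) *: (2 *: g t + c *: (0 - (- alpha * expR (- alpha * t))))); last first.
  by rewrite /GRing.scale/= /c; field; rewrite gt_eqF.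
move: h3; set F := (X in is_derive _ _ X _); rewrite (_ : F = J)//.
Qed.

Section solution.
Variables (eps : R) (x : R -> 'cV[R]_n).
Hypothesis eps_gt0 : 0 < eps.
Hypothesis eps_le1 : eps <= 1.

(** The control recovered from the state by integrating its equation; see
    [feedback_controlE]. *)
Definition control (t : R) : 'cV[R]_n := u0 + eps^-1 *: (z t + y0 t - x t).
Definition scaled_control (t : R) : 'cV[R]_n := eps *: u0 + (z t + y0 t - x t).
Let v := scaled_control.

Hypothesis x_ac : forall b, ac (fun p q => enorm (x q - x p)) 0 b.
Hypothesis x_derive : {ae mu, forall t : R, 0 <= t -> enorm (x t) <= rho ->
  is_derive t 1 x (phi t (x t) - B *m control t)}.

Lemma scaled_control_ac b : ac (fun p q => enorm (v q - v p)) 0 b.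
Proof.
have zy : ac (fun p q => enorm (z q - z p) + enorm (y0 q - y0 p)) 0 b.
  by apply: (ac_le ler01 (transient_ac b) (y0_ac b)) => p q _ _ _; rewrite mul1r.
apply: (ac_le ler01 zy (x_ac b)).
move=> p q _ _ _; rewrite mul1r.
have -> : v q - v p = (z q - z p) + (y0 q - y0 p) - (x q - x p).
  rewrite /v /scaled_control; move: (z q) (z p) => a c'.
  by apply/matrixP => i j; rewrite !mxE; ring.
by rewrite (le_trans (enormB _ _))// lerD2r enormD.
Qed.

Lemma scaled_control_bound t : 0 <= t -> enorm (x t) <= rho -> enorm (v t) <= M.
Proof.
move=> t0 xr; rewrite /v /scaled_control /M /state_bound.
have := enormD (eps *: u0) (z t + y0 t - x t).
have := enormB (z t + y0 t) (x t); have := enormD (z t) (y0 t).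
have : enorm (eps *: u0) <= enorm u0.
  by rewrite enormZ gtr0_norm// ler_piMl ?enorm_ge0.
have := y0_bound t0; have := transient_bound t0; lra.
Qed.

(** With [v] the scaled control, [v' = B v / eps + w] and [v . B v <= - beta |v|^2]
    give [(|v|^2)' <= - (2 beta / eps) |v|^2 + 2 v . w], to which [gronwall]
    applies. *)
Lemma energy_estimate s T : 0 <= s -> s <= T ->
  (forall t, 0 <= t -> t <= T -> enorm (x t) <= rho) ->
  dotv (v T) (v T) <=
    expR (- (2 * beta / eps) * (T - s)) * dotv (v s) (v s) + (J T - J s).
Proof.
move=> s0 sT xr.
have k0 : 0 <= 2 * beta / eps by rewrite divr_ge0 ?mulr_ge0// ltW.
apply: (gronwall (V := fun t => dotv (v t) (v t)) k0 sT).
- apply: ac_dotvv => //; apply: ac_sub (scaled_control_ac T) => //.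
- by apply: ac_sub (forcing_budget_ac T).
have dJx : {ae mu, forall t : R, (0 < t ->
      is_derive t 1 J (2 * M * (2 * g t + Kc * enorm eta * expR (- alpha * t)))) /\
    (0 <= t -> enorm (x t) <= rho -> is_derive t 1 x (phi t (x t) - B *m control t))}.
  by apply: filterS2 forcing_budget_derive x_derive => t.
apply: filterS3 dJx y0_derive bound_g => t [Jt xt] yt gt st tT.
have t_gt0 : 0 < t by exact: le_lt_trans s0 st.
have t0 := ltW t_gt0; have xrt := xr t t0 (ltW tT).
have {}Jt := Jt t_gt0; have {}xt := xt t0 xrt; have {}yt := yt t0; have {}gt := gt t0.
pose w := C *m z t + psi t (y0 t) - phi t (x t).
have vBw : C *m z t + psi t (y0 t) - (phi t (x t) - B *m control t) =
    eps^-1 *: (B *m v t) + w.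
  have -> : control t = eps^-1 *: v t.
    by rewrite /control /v /scaled_control [RHS]scalerDr scalerA mulVf ?gt_eqF// scale1r.
  rewrite -scalemxAr /w; move: (B *m v t) (C *m z t) => a b.
  by apply/matrixP => i j; rewrite !mxE; ring.
have dv : is_derive t 1 v (eps^-1 *: (B *m v t) + w).
  rewrite -vBw -[X in is_derive _ _ _ X]add0r.
  have h := is_deriveB (is_deriveD (is_derive_expmx_orbit C eta t) yt) xt.
  exact: (is_deriveD (is_derive_cst (eps *: u0) t 1) h).
exists (2 * dotv (v t) (eps^-1 *: (B *m v t) + w)).
exists (2 * M * (2 * g t + Kc * enorm eta * expR (- alpha * t))).
have wg : enorm w <= 2 * g t + Kc * enorm eta * expR (- alpha * t).
  have [px _] := gt _ xrt.
  have [|_ py] := gt (y0 t).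
    rewrite (le_trans (y0_bound t0))// /radius -addrA addrCA lerDl.
    by rewrite addr_ge0 ?enorm_ge0.
  rewrite (le_trans (enormB _ _))//.
  have := enormD (C *m z t) (psi t (y0 t)).
  have := CK (z t); have := ler_wpM2l (ltW Kc_gt0) (transient_decay t0).
  lra.
have G0 : 0 <= 2 * g t + Kc * enorm eta * expR (- alpha * t).
  exact: le_trans (enorm_ge0 w) wg.
split=> //.
- exact: is_derive_dotvv.
- by rewrite mulr_ge0// mulr_ge0// ltW// state_bound_gt0.
rewrite dotvDr dotvZr mulrDr lerD//.
  have h : 2 / eps * dotv (v t) (B *m v t) <= 2 / eps * (- beta * dotv (v t) (v t)).
    by rewrite ler_pM2l ?divr_gt0// Bdiss.
  have -> : 2 * (eps^-1 * dotv (v t) (B *m v t)) = 2 / eps * dotv (v t) (B *m v t) by ring.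
  by apply: (le_trans h); rewrite le_eqVlt; apply/orP; left; apply/eqP; ring.
rewrite -mulrA ler_pM2l// (le_trans (dotv_le _ _))//.
by apply: ler_pM; rewrite ?enorm_ge0// scaled_control_bound.
Qed.

(* The constants 1/6, 1/32 and 1/32 below make [|v|] at most 1/4, since
   (1/6)^2 + 1/32 and 1/32 + 1/32 are both at most (1/4)^2; then
   [|eps u0 - v|] is at most 1/6 + 1/4 < 1/2. *)
Hypothesis x0E : x 0 = xi0.
Variable d : R.
Hypothesis d_gt0 : 0 < d.
Hypothesis eps_u0 : eps * enorm u0 <= 1 / 6.
Hypothesis J_d : forall p q, 0 <= p -> p <= q -> q - p <= d -> J q - J p <= 1 / 32.
Hypothesis exp_d : expR (- (2 * beta / eps) * d) * M ^+ 2 <= 1 / 32.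

Lemma scaled_control0 : v 0 = eps *: u0.
Proof.
by rewrite /v /scaled_control /z /transient expmx_orbit0 x0E subrK subrr addr0.
Qed.

Lemma stateE t : x t = (z t + y0 t) + (eps *: u0 - v t).
Proof.
rewrite /v /scaled_control; move: (z t) => a.
by apply/matrixP => i j; rewrite !mxE; ring.
Qed.

(** The deviation of the state from the reference motion is [eps u0 - v].  Before
    time [d] the energy [|v|^2] is controlled by its small initial value; later,
    by its value at [T - d], which is only bounded but is damped over the window
    [[T - d, T]].  In both cases the forcing adds little to it. *)
Lemma state_improved T : 0 <= T ->
  (forall t, 0 <= t -> t <= T -> enorm (x t) <= rho) -> enorm (x T) <= rho - 1 / 2.
Proof.
move=> T0 xr.
have vT : dotv (v T) (v T) <= (1 / 4) ^+ 2.
  have [Td|dT] := leP T d.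
    have := energy_estimate (lexx 0) T0 xr.
    have := J_d (lexx 0) T0; rewrite subr0 => /(_ Td) Jd.
    have e1 : expR (- (2 * beta / eps) * T) <= 1.
      by rewrite -expR0 ler_expR mulNr oppr_le0 mulr_ge0// divr_ge0 ?mulr_ge0// ltW.
    have V0 : dotv (v 0) (v 0) <= (1 / 6) ^+ 2.
      rewrite scaled_control0 -sqr_enorm enormZ gtr0_norm// ler_pXn2r// ?nnegrE//.
      by rewrite mulr_ge0 ?enorm_ge0// ltW.
    have := dotvv_ge0 (v 0); move: (expR _) e1 (expR_ge0 (- (2 * beta / eps) * T)) => a; nra.
  have s0 : 0 <= T - d by rewrite subr_ge0 ltW.
  have sT : T - d <= T by rewrite gerBl ltW.
  have := energy_estimate s0 sT xr; rewrite subKr.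
  have := J_d s0 sT; rewrite subKr => /(_ (lexx _)) Jd.
  have vs : dotv (v (T - d)) (v (T - d)) <= M ^+ 2.
    rewrite -sqr_enorm ler_pXn2r ?nnegrE ?enorm_ge0 ?(ltW state_bound_gt0)//.
    by apply: scaled_control_bound => //; exact: xr.
  have := ler_wpM2l (expR_ge0 (- (2 * beta / eps) * d)) vs.
  by move: exp_d; lra.
have {}vT : enorm (v T) <= 1 / 4.
  by rewrite -(ler_pXn2r (n := 2)) ?nnegrE ?enorm_ge0// sqr_enorm.
rewrite stateE.
have := enormD (z T + y0 T) (eps *: u0 - v T); have := enormD (z T) (y0 T).
have := enormB (eps *: u0) (v T); rewrite enormZ gtr0_norm//.
have := transient_bound T0; have := y0_bound T0.
rewrite /rho /radius -/eta; move: eps_u0; lra.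
Qed.

(** A continuity argument: the ball of radius [radius] is closed, and a state
    that has stayed in it is at distance 1/2 from its boundary by
    [state_improved]. *)
Lemma state_stays t : 0 <= t -> enorm (x t) <= rho.
Proof.
move=> t0; pose P r := enorm (x r) <= rho.
apply: (@real_induction R 0 t P) => [||]; last by rewrite t0 lexx.
- move=> r /andP[r0 rt] IH; rewrite /P leNgt; apply/negP => xr.
  move: r0; rewrite le_eqVlt => /predU1P[r0|r0].
    move: xr; rewrite -r0 x0E ltNge => /negP; apply.
    have := enormD eta (y0 0); rewrite /eta subrK; have := y0_bound (lexx 0).
    by rewrite /rho /radius -/eta; lra.
  have e0 : 0 < enorm (x r) - rho by rewrite subr_gt0.
  have [h h0 hP] := ac_near (x_ac r) e0.
  pose s := Num.max 0 (r - h / 2).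
  have sr : s < r by rewrite gt_max r0 ltrBlDr ltrDl divr_gt0.
  have s0 : 0 <= s by rewrite le_max lexx.
  have rsh : r - s < h.
    by rewrite ltrBlDr -ltrBlDl lt_max; apply/orP; right; lra.
  have := hP s r s0 sr (lexx r) rsh; have Ps : P s by apply: IH; rewrite s0.
  have := enormD (x s) (x r - x s); rewrite addrC subrK.
  by move: Ps; rewrite /P; lra.
- move=> r /andP[r0 rt] IH.
  have xr := state_improved r0 (fun s s0 sr => IH s (introT andP (conj s0 sr))).
  have e0 : 0 < 1 / 2 :> R by lra.
  have [h h0 hP] := ac_near (x_ac t) e0.
  exists h => // s /andP[rs srh] st; rewrite /P.
  have := hP r s r0 rs st; rewrite ltrBlDl => /(_ srh).
  have := enormD (x r) (x s - x r); rewrite addrC subrK; lra.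
Qed.

(** Once the remaining forcing is small, the energy estimate damps what is left
    of [|v|^2], so that [v] tends to zero; so does the transient, and what
    remains of [x - y0] is [eps u0]. *)
Lemma state_limit : enorm (x t - y0 t) @[t --> +oo] --> eps * enorm u0.
Proof.
have VJ s T : 0 <= s -> s <= T ->
    dotv (v T) (v T) <= expR (- (2 * beta / eps) * (T - s)) * dotv (v s) (v s) + (J T - J s).
  by move=> s0 sT; apply: energy_estimate => // t t0 _; exact: state_stays.
set k := 2 * beta / eps in VJ.
have k0 : 0 < k by rewrite divr_gt0 ?mulr_gt0.
apply/cvgrPdist_le => e e0.
have e2 : 0 < (e / 2) ^+ 2 / 2 by rewrite divr_gt0// exprn_gt0// divr_gt0.
have [KJ JK] := forcing_budget_bounded.
have [s s0 Js] := monotone_bounded_tail e2 forcing_budget_le JK.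
near=> t.
have st : s <= t by near: t; exact: nbhs_pinfty_ge (num_real _).
have t0 := le_trans s0 st.
have h1 := VJ s t s0 st; have h2 := Js t st.
have h3 : expR (- k * (t - s)) * dotv (v s) (v s) <= (e / 2) ^+ 2 / 2.
  have -> : - k * (t - s) = - k * t + k * s by ring.
  rewrite expRD -mulrA; near: t; apply: near_expR_decay => //.
  by rewrite mulr_ge0 ?expR_ge0 ?dotvv_ge0.
have vt : enorm (v t) <= e / 2.
  rewrite -(ler_pXn2r (n := 2)) ?nnegrE ?enorm_ge0// ?divr_ge0 ?ltW// sqr_enorm.
  lra.
have zt : enorm (z t) <= e / 2.
  apply: (le_trans (transient_decay t0)); near: t.
  by apply: near_expR_decay; rewrite ?enorm_ge0 ?divr_gt0.
have -> : eps * enorm u0 = enorm (eps *: u0) by rewrite enormZ gtr0_norm.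
rewrite (le_trans (enorm_dist _ _))//.
have -> : eps *: u0 - (x t - y0 t) = v t - z t.
  by rewrite stateE; move: (z t) => a; apply/matrixP => i j; rewrite !mxE; ring.
by rewrite (le_trans (enormB _ _))// [e]splitr lerD.
Unshelve. all: by end_near. Qed.

End solution.
(** The window [d] comes from the uniform continuity of the forcing budget and
    does not depend on [eps]; a small [eps] then makes the damping over this
    window as strong as desired. *)
Lemma small_eps (delta : R) : 0 < delta -> exists eps d : R,
  [/\ 0 < eps, eps <= 1, 0 < d, eps * enorm u0 <= 1 / 6 & eps * enorm u0 < delta] /\
  (forall p q, 0 <= p -> p <= q -> q - p <= d -> J q - J p <= 1 / 32) /\
  expR (- (2 * beta / eps) * d) * M ^+ 2 <= 1 / 32.
Proof.
move=> delta0; have e32 : 0 < 1 / 32 :> R by lra.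
have [h h0 hP] := forcing_budget_near e32.
have d0 : 0 < h / 2 by rewrite divr_gt0.
have bd0 : 0 < 2 * beta * (h / 2) by rewrite !mulr_gt0.
near (pinfty_nbhs R) => t.
have t1 : 1 <= t by near: t; exact: nbhs_pinfty_ge (num_real _).
have t0 : 0 < t by exact: lt_le_trans t1.
exists t^-1, (h / 2); split; [split|split] => //.
- by rewrite invr_gt0.
- by rewrite invf_le1.
- have : 6 * enorm u0 <= t by near: t; exact: nbhs_pinfty_ge (num_real _).
  by rewrite (ler_pdivrMl _ _ t0); lra.
- have : enorm u0 / delta < t by near: t; exact: nbhs_pinfty_gt (num_real _).
  by rewrite ltr_pdivrMr// (ltr_pdivrMl _ _ t0).
- move=> p q p0 pq qph; apply: ltW; apply: hP => //.
  by rewrite (le_lt_trans qph)//; lra.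
- rewrite invrK (_ : - (2 * beta * t) * (h / 2) = - (2 * beta * (h / 2)) * t); last by ring.
  by near: t; apply: near_expR_decay => //; rewrite exprn_ge0// ltW// state_bound_gt0.
Unshelve. all: by end_near. Qed.

End gain.
End a_priori.

(** * Existence for the clamped closed loop *)

Lemma locally_lipschitz_continuous (R : realType) (n : nat)
    (f : 'cV[R]_n -> 'cV[R]_n) : locally_lipschitz f -> continuous f.
Proof.
move=> fL x; have [U xU [M [_ MP]]] := fL x.
pose L := `|M| + 1.
have L0 : 0 < L by rewrite ltr_wpDl.
have ML : M < L by rewrite (le_lt_trans (ler_norm M))// ltrDl.
have Ux : U x by exact: nbhs_singleton.
apply/(@cvgrPdist_le _ _ _ (nbhs (x : 'cV[R]_n))) => e e0; near=> y.
have Uy : U y by near: y.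
have := MP L ML (x, y) (conj Ux Uy) => /= /le_trans; apply.
rewrite mulrC -ler_pdivlMr//; near: y.
by apply: cvgr_dist_le; [exact: cvg_id|rewrite divr_gt0].
Unshelve. all: by end_near. Qed.

Section clamp.
Variables (R : realType) (n : nat) (rho : R).
Hypothesis rho_gt0 : 0 < rho.

(** Radial retraction onto the ball of radius [rho]. *)
Definition clamp (w : 'cV[R]_n) : 'cV[R]_n := (rho / Num.max rho (enorm w)) *: w.

Let max_gt0 (w : 'cV[R]_n) : 0 < Num.max rho (enorm w).
Proof. by rewrite lt_max rho_gt0. Qed.

Lemma enorm_clamp w : enorm (clamp w) <= rho.
Proof.
rewrite /clamp enormZ ger0_norm; last by rewrite divr_ge0 ?ltW ?max_gt0.
by rewrite mulrAC ler_pdivrMr// ler_pM2l// le_max lexx orbT.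
Qed.

Lemma clamp_id w : enorm w <= rho -> clamp w = w.
Proof. by move=> wr; rewrite /clamp (max_idPl wr) divff ?scale1r// gt_eqF. Qed.

Lemma enorm_continuous : continuous (@enorm R n).
Proof.
move=> w; rewrite /enorm.
apply: (@continuous_comp _ _ _ (fun w : 'cV[R]_n => \sum_(i < n) w i 0 ^+ 2) Num.sqrt).
  apply: (continuous_sumr (f := fun i (w : 'cV[R]_n) => w i 0 ^+ 2)) => i u.
  apply: (@continuous_comp _ _ _ (fun u : 'cV[R]_n => u i 0) (fun r => r ^+ 2)).
    exact: coord_continuous.
  exact: exprn_continuous.
exact: sqrt_continuous.
Qed.

Lemma clamp_continuous : continuous clamp.
Proof.
move=> w; apply: (@continuousZ _ _ _ (fun w => rho / Num.max rho (enorm w)) id); last by [].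
apply: (@continuousM _ _ (fun=> rho)); first exact: cst_continuous.
apply: continuousV; first by rewrite gt_eqF ?max_gt0.
apply: (@continuous_max _ _ (fun=> rho) (@enorm R n)); first exact: cst_continuous.
exact: enorm_continuous.
Qed.

End clamp.

Lemma mulmx_continuous (R : realType) (n : nat) (A : 'M[R]_n) :
  continuous (fun w : 'cV[R]_n => A *m w).
Proof.
move=> w; apply: (@cvg_mx _ _ _ _ (nbhs (w : 'cV[R]_n))) => i j; rewrite (ord1 j).
under eq_fun do rewrite mxE; rewrite mxE.
apply: (continuous_sumr (f := fun k (w : 'cV[R]_n) => A i k * w k 0)) => k u.
apply: (@continuousM _ _ (fun=> A i k)); first exact: cst_continuous.
exact: coord_continuous.
Qed.

Section clamped_equation.
Variables (R : realType) (n : nat) (phi : R -> 'cV[R]_n -> 'cV[R]_n).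
Variables (A : 'M[R]_n) (f : R -> 'cV[R]_n) (x0 : 'cV[R]_n) (g : R -> R) (rho F : R).
Notation mu := (@lebesgue_measure R).
Hypothesis rho_gt0 : 0 < rho.
Hypothesis phi_meas : measurable_in_time phi.
Hypothesis phi_lip : locally_lipschitz_in_space phi.
Hypothesis ig : mu.-integrable [set: R] (EFin \o g).
Hypothesis g0 : forall t, 0 <= g t.
Hypothesis phi_g : {ae mu, forall t : R, 0 <= t -> forall x, enorm x <= rho -> enorm (phi t x) <= g t}.
Hypothesis f_ac : forall b, ac (fun p q => enorm (f q - f p)) 0 b.
Hypothesis f_bound : forall t, 0 <= t -> enorm (f t) <= F.

(** Replacing the state by its retraction makes the right-hand side bounded, for
    all states, by an integrable function plus a constant, and keeps its
    continuity in the state. *)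
Lemma clamped_existence : exists x : R -> 'cV[R]_n,
  [/\ x 0 = x0, forall b, abs_continuous 0 b x &
      {ae mu, forall t : R, 0 <= t ->
         is_derive t 1 x (phi t (clamp rho (x t)) + (f t + A *m clamp rho (x t)))}].
Proof.
have [K K0 AK] := enorm_mulmx_bounded A.
have F0 : 0 <= F by rewrite (le_trans (enorm_ge0 (f 0)))// f_bound.
apply: (@caratheodory_existence _ _ g (F + K * rho) x0 ig g0 _
  (fun t w => phi t (clamp rho w) + (f t + A *m clamp rho w))).
- by rewrite addr_ge0// mulr_ge0// ltW.
- move=> v i; have [h mh hphi] := borel_version (phi_meas (clamp rho v) i).
  pose fi t := f (Num.max 0 t) i 0.
  have mfi : measurable_fun [set: R] fi.
    apply: continuous_measurable_fun => t.
    apply/cvgrPdist_lt => e e0.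
    have [d d0 dP] := ac_near (ac_coord i (f_ac (`|t| + 1))) e0.
    near=> s.
    have tsd : `|t - s| < d by near: s; exact: cvgr_dist_lt.
    have ts1 : `|t - s| < 1 by near: s; exact: cvgr_dist_lt.
    have in_range r : `|t - r| < 1 -> Num.max 0 r <= `|t| + 1.
      move=> tr; rewrite ge_max addr_ge0//=.
      have := ler_norm t; have := ler_norm (r - t); rewrite distrC; lra.
    have tmax : Num.max 0 t <= `|t| + 1 by apply: in_range; rewrite subrr normr0.
    have smax := in_range s ts1.
    have mB : `|Num.max 0 t - Num.max 0 s| <= `|t - s|.
      have := ler_norm (t - s); have := ler_norm (s - t); rewrite (distrC s) => h1 h2.
      have [t0|t0] := leP 0 t; have [s0|s0] := leP 0 s => //.
      - by rewrite subr0 ger0_norm//; lra.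
      - by rewrite sub0r normrN ger0_norm//; lra.
      - by rewrite subrr normr0.
    rewrite /fi; move: mB tmax smax; have : 0 <= Num.max 0 t by rewrite le_max lexx.
    have : 0 <= Num.max 0 s by rewrite le_max lexx.
    move: (Num.max 0 t) (Num.max 0 s) => a b b0 a0 abts am bm.
    have abd : `|a - b| < d by exact: le_lt_trans tsd.
    have [ab|ba|->] := ltgtP a b; last by rewrite subrr normr0.
    - by rewrite distrC; apply: dP => //; rewrite -(gtr0_norm (x := b - a)) ?subr_gt0// distrC.
    - by apply: dP => //; rewrite -(gtr0_norm (x := a - b)) ?subr_gt0.
  exists (fun t => h t + (fi t + (A *m clamp rho v) i 0)).
    by apply: measurable_funD => //; apply: measurable_funD.
  apply: filterS hphi => t ht t0; rewrite ht// /fi (max_idPr t0).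
  by rewrite !mxE.
- apply: filterS phi_lip => t lt t0 w.
  apply: (@continuousD _ _ _ (fun w => phi t (clamp rho w)) (fun w => f t + A *m clamp rho w)).
    apply: (@continuous_comp _ _ _ (clamp rho) (phi t)); first exact: clamp_continuous.
    by apply: locally_lipschitz_continuous; exact: lt.
  apply: (@continuousD _ _ _ (fun=> f t) (fun w => A *m clamp rho w)).
    exact: cst_continuous.
  apply: (@continuous_comp _ _ _ (clamp rho) (fun w => A *m w)); first exact: clamp_continuous.
  exact: mulmx_continuous.
- apply: filterS phi_g => t gt t0 v i; rewrite (le_trans (enorm_coord _ _))//.
  have := gt t0 (clamp rho v) (enorm_clamp rho_gt0 v).
  have := enormD (phi t (clamp rho v)) (f t + A *m clamp rho v).
  have := enormD (f t) (A *m clamp rho v); have := f_bound t0.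
  have := AK (clamp rho v).
  have := ler_wpM2l (ltW K0) (enorm_clamp rho_gt0 v).
  lra.
Unshelve. all: by end_near. Qed.

End clamped_equation.

(** * The feedback system *)

Section feedback.
Variables (R : realType) (n : nat) (phi psi : R -> 'cV[R]_n -> 'cV[R]_n).
Variables (y0 : R -> 'cV[R]_n) (C B : 'M[R]_n) (xi0 u0 : 'cV[R]_n).
Notation mu := (@lebesgue_measure R).
Let s := sliding C y0 xi0.
Let z := transient y0 C xi0.

Lemma sliding_derive_time (t : R) (x dy : 'cV[R]_n) : is_derive t 1 y0 dy ->
  is_derive t 1 (fun r => s r x) (C *m z t + dy).
Proof.
move=> yt; have zt := is_derive_expmx_orbit C (xi0 - y0 0) t.
have h := is_deriveB zt (is_deriveB (is_derive_cst x t 1) yt).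
by move: h; rewrite sub0r opprK.
Qed.

Lemma sliding_diff (t : R) (x w : 'cV[R]_n) : 'd (s t) x w = - w.
Proof.
have h := is_diffB (is_diff_cst (z t) x) (is_diffB (is_diff_id x) (is_diff_cst (y0 t) x)).
have -> : s t = cst (z t) - (id - cst (y0 t)) by [].
by rewrite diff_val !fctE/= subr0 sub0r.
Qed.

Hypothesis y0_ac : forall b, ac (fun p q => enorm (y0 q - y0 p)) 0 b.
Hypothesis y0_derive : {ae mu, forall t : R, 0 <= t -> is_derive t 1 y0 (psi t (y0 t))}.
Hypothesis z_ac : forall b, ac (fun p q => enorm (z q - z p)) 0 b.
Variables (eps : R) (x u : R -> 'cV[R]_n).
Hypothesis eps_gt0 : 0 < eps.

(** The right-hand side of the equation of the control is the derivative of
    [s(t, x(t))], and [s] vanishes at the initial point, hence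
    [eps (u - u0) = s(t, x)].  The argument is made for each coordinate, with
    [ac_constant]. *)
Lemma feedback_controlE : is_feedback_solution phi B s xi0 u0 eps x u ->
  forall t, 0 <= t -> u t = control y0 C xi0 u0 eps x t.
Proof.
move=> [x0E u0E xu_ac xu_derive] t t0.
suff main i : eps * u t i 0 + (x t i 0 - y0 t i 0 - z t i 0) = eps * u0 i 0.
  apply/matrixP => i j; rewrite (ord1 j) /control (_ : transient y0 C xi0 t = z t)//.
  move: (z t) (main i) => a maini; rewrite !mxE.
  apply: (mulfI (lt0r_neq0 eps_gt0)).
  by rewrite mulrDr mulrA mulfV ?gt_eqF// mul1r -maini; ring.
pose D r := eps * u r i 0 + (x r i 0 - y0 r i 0 - z r i 0).
suff : D t = D 0.
  rewrite /D => ->; rewrite x0E u0E /z /transient expmx_orbit0 !mxE; ring.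
have [] := xu_ac t t0; rewrite !abs_continuousE => ac_x ac_u.
apply: ac_constant => //.
  have acxu : ac (fun p q => enorm (x q - x p) + enorm (u q - u p)) 0 t.
    by apply: (ac_le ler01 ac_x ac_u) => p q _ _ _; rewrite mul1r.
  have acyz : ac (fun p q => enorm (y0 q - y0 p) + enorm (z q - z p)) 0 t.
    by apply: (ac_le ler01 (y0_ac t) (z_ac t)) => p q _ _ _; rewrite mul1r.
  apply: (ac_le (K := eps + 1) _ acxu acyz); first by rewrite addr_ge0// ltW.
  move=> p q _ _ _.
  have hx := enorm_coord (x q - x p) i; have hu := enorm_coord (u q - u p) i.
  have hy := enorm_coord (y0 q - y0 p) i; have hz := enorm_coord (z q - z p) i.
  rewrite !mxE in hx hu hy; rewrite mxE [X in _ + X]mxE in hz.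
  have -> : D q - D p = eps * (u q i 0 - u p i 0) + (x q i 0 - x p i 0)
      - (y0 q i 0 - y0 p i 0) - (z q i 0 - z p i 0).
    by rewrite /D; move: (z p) (z q) => a b; ring.
  rewrite (le_trans (ler_normB _ _))//.
  have := ler_normB (eps * (u q i 0 - u p i 0) + (x q i 0 - x p i 0)) (y0 q i 0 - y0 p i 0).
  have := ler_normD (eps * (u q i 0 - u p i 0)) (x q i 0 - x p i 0).
  rewrite normrM (gtr0_norm eps_gt0).
  have := ler_wpM2l (ltW eps_gt0) hu.
  have := mulr_ge0 (ltW eps_gt0) (enorm_ge0 (x q - x p)).
  have := mulr_ge0 (ltW eps_gt0) (enorm_ge0 (y0 q - y0 p)).
  have := mulr_ge0 (ltW eps_gt0) (enorm_ge0 (z q - z p)).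
  have := enorm_ge0 (u q - u p).
  lra.
apply: filterS2 xu_derive y0_derive => r xur yr r_gt0 _.
have r0 := ltW r_gt0; have [xr ur uE] := xur r0; have {}yr := yr r0.
have zr := is_derive_expmx_orbit C (xi0 - y0 0) r; rewrite -/(z r) in zr.
move: uE; rewrite sliding_diff (derive_val (is_derive := sliding_derive_time (x r) yr)) => uE.
have {}ur : is_derive r 1 u ('D_1 u r) by exact/derivableP.
have h := is_deriveD (@is_deriveZ _ _ _ u eps _ _ _ ur) (is_deriveB (is_deriveB xr yr) zr).
have /is_derive_cV/(_ i) := h.
have -> : eps *: 'D_1 u r + (phi r (x r) - B *m u r - psi r (y0 r) - C *m z r) = 0.
  by rewrite uE; move: (C *m z r) (B *m u r) => a b; apply/matrixP => k l; rewrite !mxE; ring.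
rewrite mxE; congr (is_derive _ _ _ _).
by apply/funext => q; rewrite /D !fctE !mxE.
Qed.

End feedback.

Theorem theorem4 (R : realType) (n : nat)
    (phi psi : R -> 'cV[R]_n -> 'cV[R]_n)
    (phi_meas : measurable_in_time phi) (psi_meas : measurable_in_time psi)
    (phi_lip : locally_lipschitz_in_space phi)
    (psi_lip : locally_lipschitz_in_space psi)
    (phi_psi_bounded : integrably_bounded phi psi)
    (phi_ext : solutions_extendable phi) (psi_ext : solutions_extendable psi)
    (y0 : R -> 'cV[R]_n) (y0_sol : is_solution psi +oo%E y0)
    (y0_bounded : exists M : R, forall t : R, 0 <= t -> enorm (y0 t) <= M)
    (C : 'M[R]_n) (alpha : R) (alpha_gt0 : 0 < alpha)
    (C_sym : C \is symmetricmx)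
    (C_eig : forall a : R, eigenvalue C a -> a <= - alpha)
    (xi0 : 'cV[R]_n)
    (B : 'M[R]_n) (B_neg : negative_definite B)
    (u0 : 'cV[R]_n) (delta : R) (delta_gt0 : 0 < delta) :
  exists eps : R, 0 < eps /\
    (exists x u : R -> 'cV[R]_n,
       is_feedback_solution phi B (sliding C y0 xi0) xi0 u0 eps x u) /\
    (forall x u : R -> 'cV[R]_n,
       is_feedback_solution phi B (sliding C y0 xi0) xi0 u0 eps x u ->
       cvg (enorm (x t - y0 t) @[t --> +oo]) /\
       lim (enorm (x t - y0 t) @[t --> +oo]) < delta).
Proof.
have [y0_acT y0_derT] := y0_sol; have [Y y0_bound] := y0_bounded.
have y0_ac b : ac (fun p q => enorm (y0 q - y0 p)) 0 b.
  apply: (@ac_sub _ _ 0 `|b|) => //; first exact: ler_norm.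
  by rewrite -abs_continuousE; apply: y0_acT; rewrite ?ltry.
have y0_derive : {ae lebesgue_measure, forall t : R, 0 <= t ->
    is_derive t 1 y0 (psi t (y0 t))}.
  by apply: filterS y0_derT => t yt t0; apply: yt; rewrite ?ltry.
have [beta beta_gt0 Bdiss] := negative_definite_bound B_neg.
have Cdiss := symmetric_eigenvalue_bound C_sym C_eig.
have [Kc Kc_gt0 CK] := enorm_mulmx_bounded C.
have [KB KB_gt0 BK] := enorm_mulmx_bounded B.
pose rho := radius y0 xi0 Y.
have Y0 : 0 <= Y by rewrite (le_trans (enorm_ge0 (y0 0)))// y0_bound.
have rho_gt0 : 0 < rho by rewrite /rho /radius ltr_wpDl// addr_ge0 ?enorm_ge0.
have [gamma igamma gamma_bound] := phi_psi_bounded rho rho_gt0.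
have [g [ig g0 gamma_g]] := integrable_borel_bound igamma.
have bound_g : {ae lebesgue_measure, forall t : R, 0 <= t -> forall x, enorm x <= rho ->
    enorm (phi t x) <= g t /\ enorm (psi t x) <= g t}.
  apply: filterS2 gamma_g gamma_bound => t tg tb t0 x xr.
  have [px py] := tb t0 x xr; have gt := tg t0.
  by split; [exact: le_trans gt|exact: le_trans gt].
have [eps [d [[eps_gt0 eps_le1 d_gt0 eps_u0 eps_delta] [Jd expd]]]] :=
  small_eps xi0 u0 alpha_gt0 beta_gt0 y0_bound ig g0 Kc_gt0 delta_gt0.
have z_ac := transient_ac y0 xi0 alpha_gt0 Cdiss.
exists eps; split=> //.
pose u_of x := control y0 C xi0 u0 eps x.
split.
(* Eliminating [u] leaves the equation [x' = phi(t, x) + f t + eps^-1 B x]; its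
   clamped version has a solution, on which the clamp turns out to be inert. *)
- pose f t := - (B *m (u0 + eps^-1 *: (transient y0 C xi0 t + y0 t))).
  have f_ac b : ac (fun p q => enorm (f q - f p)) 0 b.
    apply: (ac_le (K := KB * eps^-1) _ (z_ac b) (y0_ac b)).
      by rewrite mulr_ge0 ?invr_ge0// ltW.
    move=> p q _ _ _.
    have -> : f q - f p = - (B *m (eps^-1 *: ((transient y0 C xi0 q - transient y0 C xi0 p)
        + (y0 q - y0 p)))).
      rewrite /f -opprB opprK addrC -mulmxBr; congr (- (B *m _)).
      move: (transient _ _ _ p) (transient _ _ _ q) => a b'.
      by apply/matrixP => i j; rewrite !mxE; ring.
    rewrite enormN (le_trans (BK _))// enormZ gtr0_norm ?invr_gt0// mulrA ler_pM2l ?enormD//.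
    by rewrite mulr_gt0 ?invr_gt0.
  have f_bound t : 0 <= t ->
      enorm (f t) <= KB * (enorm u0 + eps^-1 * (enorm (xi0 - y0 0) + Y)).
    move=> t0; rewrite /f enormN (le_trans (BK _))// ler_pM2l// (le_trans (enormD _ _))//.
    rewrite lerD2l enormZ gtr0_norm ?invr_gt0// ler_pM2l ?invr_gt0//.
    rewrite (le_trans (enormD _ _))// lerD ?y0_bound//.
    exact: (transient_bound y0 xi0 alpha_gt0 Cdiss).
  have phi_g : {ae lebesgue_measure, forall t : R, 0 <= t -> forall x, enorm x <= rho ->
      enorm (phi t x) <= g t}.
    by apply: filterS bound_g => t tb t0 x xr; have [] := tb t0 x xr.
  have [x [x0E x_ac x_der]] := clamped_existence (eps^-1 *: B) xi0
    rho_gt0 phi_meas phi_lip ig g0 phi_g f_ac f_bound.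
  have {}x_ac b : ac (fun p q => enorm (x q - x p)) 0 b by exact: x_ac.
  have x_derive : {ae lebesgue_measure, forall t : R, 0 <= t -> enorm (x t) <= rho ->
      is_derive t 1 x (phi t (x t) - B *m u_of x t)}.
    apply: filterS x_der => t xt t0 xr; have := xt t0; rewrite clamp_id//.
    congr (is_derive _ _ _ _); congr (_ + _).
    have -> : u_of x t = u0 + eps^-1 *: (transient y0 C xi0 t + y0 t) - eps^-1 *: x t.
      by rewrite /u_of /control scalerBr addrA.
    by rewrite mulmxBr opprB -scalemxAl scalemxAr addrC.
  have x_stays t : 0 <= t -> enorm (x t) <= rho.
    exact: (state_stays alpha_gt0 beta_gt0 Cdiss Bdiss y0_ac y0_derive y0_bound
      ig g0 bound_g Kc_gt0 CK eps_gt0 eps_le1 x_ac x_derive x0E d_gt0 eps_u0 Jd expd).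
  exists x, (u_of x); split=> //.
  + by rewrite /u_of /control /transient expmx_orbit0 x0E subrK subrr scaler0 addr0.
  + move=> b b0; split; rewrite abs_continuousE; first exact: x_ac.
    have zy : ac (fun p q => enorm (transient y0 C xi0 q - transient y0 C xi0 p)
        + enorm (y0 q - y0 p)) 0 b.
      by apply: (ac_le ler01 (z_ac b) (y0_ac b)) => p q _ _ _; rewrite mul1r.
    apply: (ac_le (K := eps^-1) _ zy (x_ac b)); first by rewrite invr_ge0 ltW.
    move=> p q _ _ _.
    have -> : u_of x q - u_of x p = eps^-1 *: ((transient y0 C xi0 q - transient y0 C xi0 p)
        + (y0 q - y0 p) - (x q - x p)).
      rewrite /u_of /control; move: (transient _ _ _ p) (transient _ _ _ q) => a b'.
      by apply/matrixP => i j; rewrite !mxE; ring.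
    rewrite enormZ gtr0_norm ?invr_gt0// ler_pM2l ?invr_gt0//.
    by rewrite (le_trans (enormB _ _))// lerD2r enormD.
  + apply: filterS2 x_derive y0_derive => t xt yt t0.
    have {}xt := xt t0 (x_stays t t0); have {}yt := yt t0.
    have zt := is_derive_expmx_orbit C (xi0 - y0 0) t.
    have ut := is_deriveD (is_derive_cst u0 t 1)
      (@is_deriveZ _ _ _ _ eps^-1 _ _ _ (is_deriveB (is_deriveD zt yt) xt)).
    have {}ut : is_derive t 1 (u_of x) _ := ut.
    split; [exact: xt|by have [] := ut|].
    rewrite sliding_diff (derive_val (is_derive := ut)).
    rewrite (derive_val (is_derive := sliding_derive_time C xi0 (x t) yt)).
    by rewrite add0r scalerA mulfV ?gt_eqF// scale1r.
- move=> x u xu; have [x0E _ xu_ac xu_derive] := xu.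
  have uE := feedback_controlE y0_ac y0_derive z_ac eps_gt0 xu.
  have x_ac b : ac (fun p q => enorm (x q - x p)) 0 b.
    apply: (@ac_sub _ _ 0 `|b|) => //; first exact: ler_norm.
    by rewrite -abs_continuousE; have [] := xu_ac `|b| (normr_ge0 b).
  have x_derive : {ae lebesgue_measure, forall t : R, 0 <= t -> enorm (x t) <= rho ->
      is_derive t 1 x (phi t (x t) - B *m u_of x t)}.
    apply: filterS xu_derive => t xut t0 _; have [xt _ _] := xut t0.
    by rewrite /u_of -uE.
  have lim_x := state_limit alpha_gt0 beta_gt0 Cdiss Bdiss y0_ac y0_derive y0_bound
      ig g0 bound_g Kc_gt0 CK eps_gt0 eps_le1 x_ac x_derive x0E d_gt0 eps_u0 Jd expd.
  split; first by apply/cvg_ex; exists (eps * enorm u0).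
  by rewrite (cvg_lim _ lim_x).
Qed.
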